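(* Let $P$ be a transition matrix over a lattice $\Lambda$ and a countable alphabet $\mathcal{A}$, such that the pair $(\Lambda,\mathrm{Exp}(1))$ is causal, and let $I$ denote the identity transition matrix. Then for all $\lambda\in(0,1]$: $$(\zeta_t)_{t\ge 0}\in \mathrm{IPS}(P)\quad\text{if and only if}\quad (\zeta_{\lambda t})_{t\ge 0}\in \mathrm{IPS}(\lambda P+(1-\lambda)I).$$
   Context: A lattice is a countable set $\Lambda$ of sites in which each $j\in\Lambda$ has a neighbourhood $\mathcal{N}_j\subseteq\Lambda$ with $j\in\mathcal{N}_j$. A transition matrix $P$ is a collection of probability distributions $P_j(\cdot\,|\,\sigma)$ on the countable alphabet $\mathcal{A}$, one for each $j\in\Lambda$ and $\sigma\in\mathcal{A}^{\mathcal{N}_j}$; for $\zeta\in\mathcal{A}^\Lambda$ one writes $P_j(\cdot\,|\,\zeta):=P_j(\cdot\,|\,\zeta|_{\mathcal{N}_j})$. The identity transition matrix is $I_j(a\,|\,\sigma)=1$ if $\sigma(j)=a$ and $0$ otherwise. Convex combinations of transition matrices are taken entrywise. Clocks: let $(\rho_n^j)_{n\ge1,\,j\in\Lambda}$ be i.i.d. $\mathrm{Exp}(1)$ random variables, $\tau_0^j=0$ and $\tau_n^j=\rho_1^j+\dots+\rho_n^j$. Put $\mathbf{Update}=\{(\tau_n^j,j): n\ge 0,\ j\in\Lambda\}$. Causality: for $(t,j)\in[0,\infty)\times\Lambda$ put $t_0=t$, $K_0=\{j\}$ and, recursively, as long as $t_n>0$, $t_{n+1}=\max\{0\le s<t_n:\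 (\{s\}\times K_n)\cap\mathbf{Update}\ne\varnothing\}$, $J_{n+1}=\{i\in K_n:(t_{n+1},i)\in\mathbf{Update}\}$, $K_{n+1}=K_n\cup\bigcup_{i\in J_{n+1}}\mathcal{N}_i$. The pair $(\Lambda,\mathrm{Exp}(1))$ is causal if for every $(t,j)$ almost surely $t_n=0$ for some finite $n$. Trajectory: given an initial distribution $\mu_0$ on $\mathcal{A}^\Lambda$, $\zeta_0\sim\mu_0$ (independent of the clocks); $\zeta_t(j)=\zeta_{\tau_n^j}(j)$ for $t\in[\tau_n^j,\tau_{n+1}^j)$; and for $n\ge1$ the value $\zeta_{\tau_n^j}(j)$ is sampled from $P_j(\cdot\,|\,\zeta_{(\tau_n^j)^-})$ independently of everything else, where $\zeta_{\tau^-}$ is the left limit at $\tau$. Causality makes this well defined. $\mathrm{IPS}(P)$ is the set of laws of $(\zeta_t)_{t\ge0}$, indexed by all initial distributions; $(\zeta_t)_{t\ge0}\in\mathrm{IPS}(P)$ means that the law of the process $(\zeta_t)_{t\ge0}$ belongs to this set. *)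

(* Defs.v *)
From HB Require Import structures.
From mathcomp Require Import all_boot all_order all_algebra.
From mathcomp Require Import all_classical all_reals all_analysis.

Set Implicit Arguments.
Unset Strict Implicit.
Unset Printing Implicit Defensive.

Import Order.TTheory GRing.Theory Num.Theory.
Import numFieldNormedType.Exports.

Local Open Scope classical_set_scope.
Local Open Scope ring_scope.

Record lattice := Lattice {
  site :> countType;
  nbhd : site -> set site;
  nbhd_self : forall j, nbhd j j }.

Definition self_nbhd (L : lattice) (j : L) : nbhd j :=
  exist _ j (mem_set (nbhd_self j)).

Section transition_matrices.
Context (R : realType) (L : lattice) (A : pointedType).

(* [P j sigma a] is P_j(a | sigma), for sigma in A^{N_j}. *)
Record transition_matrix := TransitionMatrix {
  entry :> forall j : L, (nbhd j -> A) -> A -> R;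
  entry_ge0 : forall j (sigma : nbhd j -> A) a, 0 <= entry sigma a;
  entry_sum1 : forall j (sigma : nbhd j -> A),
    (\esum_(a in [set: A]) (entry sigma a)%:E = 1)%E }.

Definition id_entry (j : L) (sigma : nbhd j -> A) (a : A) : R :=
  (sigma (self_nbhd j) == a)%:R.

Lemma id_entry_ge0 j sigma a : 0 <= @id_entry j sigma a.
Proof. exact: ler0n. Qed.

Lemma id_entry_sum1 j sigma :
  (\esum_(a in [set: A]) (@id_entry j sigma a)%:E = 1)%E.
Proof.
pose b := sigma (self_nbhd j).
rewrite (esumID [set b]); last by move=> a _; rewrite lee_fin.
rewrite !setTI esum_set1 ?lee_fin// /id_entry eqxx esum1 ?adde0//.
by move=> a /= ab; rewrite (_ : _ == a = false)//; apply/eqP => ba; apply: ab.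
Qed.

Definition id_matrix : transition_matrix :=
  TransitionMatrix id_entry_ge0 id_entry_sum1.

Section convex_combination.
Context (lam : R) (lam0 : 0 <= lam) (lam1 : lam <= 1) (P Q : transition_matrix).

Definition conv_entry (j : L) (sigma : nbhd j -> A) (a : A) : R :=
  lam * P j sigma a + (1 - lam) * Q j sigma a.

Lemma conv_entry_ge0 j sigma a : 0 <= @conv_entry j sigma a.
Proof. by rewrite addr_ge0// mulr_ge0 ?subr_ge0 ?entry_ge0. Qed.

Lemma esum_scale (c : R) (p : A -> R) : 0 <= c -> (forall a, 0 <= p a) ->
  (\esum_(a in [set: A]) (p a)%:E = 1)%E ->
  (\esum_(a in [set: A]) (c * p a)%:E = c%:E)%E.
Proof.
move=> c0 p0 p1; rewrite -[RHS]mule1 -p1 /esum -ereal_supZl//; last first.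
  by apply/set0P; exists (\sum_(x \in set0) (p x)%:E)%E, set0.
congr ereal_sup; rewrite image_comp; apply: eq_imagel => F _ /=.
by rewrite ge0_mule_fsumr// => a; rewrite lee_fin.
Qed.

Lemma conv_entry_sum1 j sigma :
  (\esum_(a in [set: A]) (@conv_entry j sigma a)%:E = 1)%E.
Proof.
under eq_esum do rewrite EFinD.
rewrite esumD; [|by move=> a _; rewrite lee_fin mulr_ge0 ?subr_ge0 ?entry_ge0..].
rewrite !esum_scale ?subr_ge0//; [|exact: entry_ge0|exact: entry_sum1..|
  exact: entry_ge0|exact: entry_sum1].
by rewrite -EFinD addrC subrK.
Qed.

Definition conv_matrix : transition_matrix :=
  TransitionMatrix conv_entry_ge0 conv_entry_sum1.

End convex_combination.

End transition_matrices.

Section spaces.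
Context (R : realType) (L : lattice) (A : pointedType).

(* For countable A, the sigma-algebras generated by the coordinate events
   below are the products of the discrete sigma-algebra on A. *)
Definition config_cylinders : set (set (L -> A)) :=
  [set B | exists j a, B = [set z | z j = a]].

Definition config := g_sigma_algebraType config_cylinders.

Definition path_cylinders : set (set ({nonneg R} -> L -> A)) :=
  [set B | exists t j a, B = [set x | x t j = a]].

Definition path_space := g_sigma_algebraType path_cylinders.

Definition rescale (lam : R) (lam0 : 0 <= lam) (x : path_space) : path_space :=
  fun t => x (NngNum (mulr_ge0 lam0 (ge0 t))).

Lemma measurable_rescale (lam : R) (lam0 : 0 <= lam) :
  measurable_fun [set: path_space] (rescale lam0).
Proof.
apply: (@measurability _ _ _ _ [set: path_space] (rescale lam0) path_cylinders) => //.
move=> _ [_ [t [j [a ->]]] <-]; rewrite setTI.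
apply: sub_sigma_algebra.
by exists (NngNum (mulr_ge0 lam0 (ge0 t))), j, a.
Qed.

HB.instance Definition _ (lam : R) (lam0 : 0 <= lam) :=
  isMeasurableFun.Build _ _ _ _ (rescale lam0) (measurable_rescale lam0).

End spaces.

Definition independent d (T : measurableType d) (R : realType)
    (Pr : probability T R) (I : eqType) (F : I -> set (set T)) :=
  forall (s : seq I) (E : I -> set T), uniq s ->
    (forall i, i \in s -> F i (E i)) ->
    (Pr (\bigcap_(i in [set` s]) E i) = \prod_(i <- s) Pr (E i))%E.

Section clocks.
Context (R : realType) (L : lattice).

(* Indices are shifted: [rho n j] is the waiting time rho_{n+1}^j. *)
Definition waiting_times d (T : measurableType d) (Pr : probability T R) :=
  nat -> L -> {RV Pr >-> R}.

Definition sigma_RV d (T : measurableType d) d' (T' : measurableType d')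
  (f : T -> T') : set (set T) := preimage_set_system [set: T] f measurable.

Definition exp1 d (T : measurableType d) (Pr : probability T R)
    (rho : waiting_times Pr) :=
  forall n j B, measurable B -> distribution Pr (rho n j) B = exponential_prob 1 B.

Definition tau d (T : measurableType d) (Pr : probability T R)
  (rho : waiting_times Pr) (n : nat) (j : L) (w : T) : R :=
  \sum_(k < n) rho k j w.

Definition update d (T : measurableType d) (Pr : probability T R)
  (rho : waiting_times Pr) (w : T) : set (R * L) :=
  [set p | exists n j, p = (tau rho n j w, j)].

Definition is_max (S : set R) (m : R) := S m /\ forall s, S s -> s <= m.

(* [backtrack U t j n s K] states that t_n and K_n are defined, and equal to
   s and K, for the recursion started at (t, j); the recursion stops when
   t_n = 0 or when the maximum defining t_{n+1} does not exist. *)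
Inductive backtrack (U : set (R * L)) (t : R) (j : L) :
    nat -> R -> set L -> Prop :=
| backtrack0 : backtrack U t j 0 t [set j]
| backtrackS n s K s' :
    backtrack U t j n s K -> 0 < s ->
    is_max [set r | 0 <= r < s /\ exists i, K i /\ U (r, i)] s' ->
    backtrack U t j n.+1 s'
      (K `|` \bigcup_(i in [set i | K i /\ U (s', i)]) nbhd i).

Definition causal_exp1 :=
  forall d (T : measurableType d) (Pr : probability T R)
    (rho : waiting_times Pr),
    exp1 rho ->
    independent Pr (fun p : nat * L => sigma_RV (rho p.1 p.2)) ->
    forall (t : R) (j : L), 0 <= t ->
      {ae Pr, forall w, exists n K, backtrack (update rho w) t j n 0 K}.

End clocks.

Section interacting_particle_systems.
Context (R : realType) (L : lattice) (A : pointedType).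

Definition left_limit (x : {nonneg R} -> L -> A) (s : {nonneg R}) (i : L)
    (a : A) :=
  exists2 e : R, 0 < e &
    forall u : {nonneg R}, s%:num - e < u%:num < s%:num -> x u i = a.

Section driving_randomness.
Context d (T : measurableType d) (Pr : probability T R).

(* [S n j w] is a random map A^{N_j} -> A giving, for every possible local
   configuration sigma, the value sampled at site j at time tau_{n+1}^j if
   the configuration just before is sigma.  Nothing is required of the joint
   law of [S n j w sigma] and [S n j w sigma']: at most one of them is used. *)
Definition samples := nat -> forall j : L, T -> (nbhd j -> A) -> A.

Definition sigma_sample (S : samples) (n : nat) (j : L) : set (set T) :=
  <<s [set B | exists sigma a, B = [set w | S n j w sigma = a]] >>.

Definition samples_from (P : transition_matrix R L A) (S : samples) :=
  forall n j sigma a,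
    measurable [set w | S n j w sigma = a] /\
    Pr [set w | S n j w sigma = a] = (P j sigma a)%:E.

Definition driving (rho : waiting_times L Pr) (S : samples)
    (X : T -> path_space R L A) (i : unit + nat * L + nat * L) :
    set (set T) :=
  match i with
  | inl (inl _) => sigma_RV (fun w => X w (NngNum (lexx 0)) : config L A)
  | inl (inr (n, j)) => sigma_RV (rho n j)
  | inr (n, j) => sigma_sample S n j
  end.

Definition constant_between_clocks (rho : waiting_times L Pr)
    (X : T -> path_space R L A) (w : T) :=
  forall n j (s t : {nonneg R}), s%:num = tau rho n j w ->
    tau rho n j w <= t%:num < tau rho n.+1 j w -> X w t j = X w s j.

Definition updated_at_clocks (rho : waiting_times L Pr) (S : samples)
    (X : T -> path_space R L A) (w : T) :=
  forall n j (s : {nonneg R}) (sigma : nbhd j -> A),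
    s%:num = tau rho n.+1 j w ->
    (forall i : nbhd j, left_limit (X w) s (val i) (sigma i)) ->
    X w s j = S n j w sigma.

Definition trajectory (P : transition_matrix R L A)
    (mu0 : probability (config L A) R) (X : {RV Pr >-> path_space R L A}) :=
  exists (rho : waiting_times L Pr) (S : samples),
    [/\ exp1 rho,
        samples_from P S,
        (forall B : set (config L A), measurable B ->
           Pr [set w | B (X w (NngNum (lexx 0)))] = mu0 B),
        independent Pr (driving rho S X) &
        {ae Pr, forall w, constant_between_clocks rho X w /\
                          updated_at_clocks rho S X w}].

End driving_randomness.

(* Laws are compared on measurable sets only: the value of a [probability] on
   a non-measurable set carries no information. *)
Definition IPS (P : transition_matrix R L A) :
    set (probability (path_space R L A) R) :=
  [set mu | exists (mu0 : probability (config L A) R)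
      d (T : measurableType d) (Pr : probability T R)
      (X : {RV Pr >-> path_space R L A}),
      trajectory P mu0 X /\
      forall B, measurable B -> mu B = distribution Pr X B].

End interacting_particle_systems.

(* Main.v *)
Require Import Defs.
From HB Require Import structures.
From mathcomp Require Import all_boot all_order all_algebra.
From mathcomp Require Import all_classical all_reals all_analysis.
From mathcomp Require Import measurable_realfun ring lra.

(** Let [Q] be the lazy matrix, which follows [P] with probability [lam] and
    otherwise leaves the site unchanged.  A trajectory of [Q] updates every
    site at rate [1], and keeps each update, independently, with probability
    [lam].  By the thinning property of Poisson processes the kept updates of
    a site form a Poisson process of rate [lam], that is, after multiplying
    time by [lam], of rate [1]; and a discarded update has no effect.  So a
    process and its time change can be made trajectories of [P] and [Q] on the
    same probability space ([coupling]).  This gives the equivalence as soon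
    as the law of a trajectory is determined by the matrix and the initial
    distribution ([trajectory_law_unique]): any given trajectory of [P], or of
    [Q], can then be replaced by the coupled one.

    The coupling lives on the probability space of the given trajectory.  Its
    clocks form an i.i.d. family of exponential variables independent of the
    initial configuration.  Half of them (even indices) are used as clocks for
    [Q], the other half (odd indices) as marks.  A mark above the threshold
    [- ln lam] is a success and has probability [lam]; by lack of memory its
    excess over the threshold is again exponential, and serves to sample from
    [P].  Thinning maps the family of clocks and marks to the family of
    rescaled waiting times between successes and of excesses.  The heart of
    the matter is that this map preserves the law ([thin_preserves_law] for
    one site, [exp_driver_thinned] for all sites).  It rests on a renewal
    argument: conditioning on the first mark shows that the tail of the first
    waiting time, jointly with everything that follows it, solves a fixpoint
    equation which is a contraction ([fixpoint_unique]) and which the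
    exponential tail solves as well ([tail_convolution]).

    Existence of trajectories and uniqueness of their law both use causality.
    Causality forces the neighbourhoods to be finite ([causal_finite_nbhd]),
    and makes the tree of updates on which a given value depends almost surely
    finite ([regular_ae]).  Hence values can be computed recursively from the
    clocks, the samples and the initial configuration, which constructs a
    measurable process ([measurable_graphical]).

    For uniqueness the samples of a trajectory cannot be treated as a random
    variable with a prescribed law, since the joint law of the samples for
    different local configurations is not prescribed.  Instead, the event that
    finitely many values are given is split, up to a null set, into countably
    many disjoint events ([explanation]), each of which fixes the finite
    dependency structure and the values of all updates in it.  On such an
    event only one local configuration is used at each update, so independence
    expresses its probability as a product that involves only the law of the
    clocks, the matrix and the initial distribution ([explanation_weight]). *)

Set Implicit Arguments.
Unset Strict Implicit.
Unset Printing Implicit Defensive.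

Import Order.TTheory GRing.Theory Num.Theory.
Import numFieldNormedType.Exports.

Local Open Scope classical_set_scope.
Local Open Scope ring_scope.

(** * Independence and almost sure equality *)

Lemma bigcap_cons (I : eqType) (U : Type) (i : I) (s : seq I) (E : I -> set U) :
  \bigcap_(k in [set` i :: s]) E k = E i `&` \bigcap_(k in [set` s]) E k.
Proof.
apply/seteqP; split => w.
  move=> ws; split; first by apply: ws; rewrite /= inE eqxx.
  by move=> k /= ks; apply: ws; rewrite /= inE ks orbT.
by move=> [wi ws] k /=; rewrite inE => /orP[/eqP ->//|]; exact: ws.
Qed.

Lemma ae_eq_measure d (T : measurableType d) (R : realType)
    (m : {measure set T -> \bar R}) (A B : set T) :
  measurable A -> measurable B -> {ae m, forall w, A w <-> B w} -> m A = m B.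
Proof.
move=> mA mB [N [mN N0 ABN]].
have le_m (C D : set T) : measurable C -> measurable D ->
    (forall w, ~ N w -> C w -> D w) -> (m C <= m D)%E.
  move=> mC mD CD; rewrite -[leRHS]adde0 -N0.
  apply: le_trans (measureU2 _ mD mN).
  apply: le_measure; rewrite ?inE//; first exact: measurableU.
  by move=> w Cw; have [Nw|Nw] := pselect (N w); [right|left; exact: CD].
by apply/eqP; rewrite eq_le !le_m// => w Nw;
  have [] : A w <-> B w by [apply: contrapT => nAB; exact/Nw/ABN].
Qed.

Section independence.
Context d (T : measurableType d) (R : realType) (Pr : probability T R).

(** Since [phi] is injective, events indexed by [J] can be transported to
    [I] without merging two of them. *)
Lemma independent_sub (I J : eqType) (F : I -> set (set T)) (G : J -> set (set T))
    (phi : J -> I) : injective phi -> (forall j, G j `<=` F (phi j)) ->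
  independent Pr F -> independent Pr G.
Proof.
move=> phi_inj GF indF s E us GE.
pose E' i := \bigcap_(j in [set j | phi j = i]) E j.
have E'E j : E' (phi j) = E j.
  rewrite /E' (_ : [set _ | _] = [set j]) ?bigcap_set1//.
  by apply/seteqP; split => k /=; [exact: phi_inj|move=> ->].
have := indF (map phi s) E'; rewrite map_inj_uniq// => /(_ us).
rewrite big_map; under eq_bigr do rewrite E'E.
move=> <-.
  congr (Pr _); apply/seteqP; split => w sw i /=.
    by move/mapP => [j js ->]; rewrite E'E; exact: sw.
  by move=> si; rewrite -E'E; apply: sw => /=; exact: map_f.
by move=> _ /mapP[j js ->]; rewrite E'E; apply: GF; exact: GE.
Qed.

(** Both sides are finite measures in [A]. *)
Lemma pi_lambda_independent (G : set (set T)) (H : set T) :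
  G `<=` measurable -> measurable H -> setI_closed G -> G setT ->
  (forall A, G A -> (Pr (A `&` H) = Pr A * Pr H)%E) ->
  forall A, <<s G >> A -> (Pr (A `&` H) = Pr A * Pr H)%E.
Proof.
move=> mG mH GI GT GH A sA.
have PrH0 : 0 <= fine (Pr H) by rewrite fine_ge0.
pose m2 := mscale (NngNum PrH0) Pr.
have m2E B : m2 B = (Pr B * Pr H)%E.
  by rewrite /m2 /mscale/= fineK ?fin_num_measure// muleC.
rewrite -m2E.
apply: (@g_sigma_algebra_measure_unique _ R T G mG (fun=> setT) _ _
  (mrestr Pr mH) m2) => //.
- by rewrite bigcup_const.
- by move=> B GB; rewrite /= /mrestr GH// -m2E.
- move=> _; rewrite /= /mrestr setTI.
  by rewrite (le_lt_trans (probability_le1 _ _)) ?ltry.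
Qed.

Let block (I K : eqType) (F : I -> set (set T)) (b : I -> K) k :=
  \bigcup_(i in [set i | b i = k]) F i.

Lemma sigma_measurable (G : set (set T)) : G `<=` measurable ->
  <<s G >> `<=` measurable.
Proof. by move=> mG; apply: smallest_sub => //; exact: sigma_algebra_measurable. Qed.

(** The induction on the list of blocks replaces the rectangles of one block
    at a time by arbitrary events of the sigma-algebra of that block; this is
    why a rectangle [H] of the untouched indices is carried along. *)
Let independent_blocks_aux (I K : eqType) (F : I -> set (set T)) (b : I -> K) :
  (forall i, F i `<=` measurable) -> (forall i, setI_closed (F i)) ->
  independent Pr F ->
  forall (s : seq K) (A : K -> set T), uniq s ->
    (forall k, k \in s -> <<s block F b k >> (A k)) ->
  forall (r : seq I) (E : I -> set T), uniq r ->
    (forall i, i \in r -> F i (E i)) -> (forall i, i \in r -> b i \notin s) ->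
  (Pr (\bigcap_(k in [set` s]) A k `&` \bigcap_(i in [set` r]) E i) =
   (\prod_(k <- s) Pr (A k)) * \prod_(i <- r) Pr (E i))%E.
Proof.
move=> mF FI indF; elim => [|k s IH] A.
  move=> _ _ r E ur FE _; rewrite big_nil mul1e -indF//; congr (Pr _).
  by rewrite set_nil bigcap_set0 setTI.
rewrite cons_uniq => /andP[ks us] sA r E ur FE rs.
have mblock k' : <<s block F b k' >> `<=` measurable.
  by apply: sigma_measurable => B [i _]; exact: mF.
have mA k' : k' \in k :: s -> measurable (A k') by move=> /sA /mblock.
have mE : measurable (\bigcap_(i in [set` r]) E i).
  apply: fin_bigcap_measurable; first exact: finite_seq.
  by move=> i ir; apply: (mF i); exact: FE.
set Es := \bigcap_(i in [set` r]) E i in mE *.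
have mAs : measurable (\bigcap_(k' in [set` s]) A k').
  apply: fin_bigcap_measurable; first exact: finite_seq.
  by move=> k' k's; apply: mA; rewrite inE k's orbT.
have -> : \bigcap_(k' in [set` k :: s]) A k' `&` Es =
    A k `&` (\bigcap_(k' in [set` s]) A k' `&` Es).
  by rewrite bigcap_cons setIA.
have IHs : (Pr (\bigcap_(k' in [set` s]) A k' `&` Es) =
   (\prod_(k' <- s) Pr (A k')) * \prod_(i <- r) Pr (E i))%E.
  apply: IH => // [k' k's|i ir]; first by apply: sA; rewrite inE k's orbT.
  by have := rs i ir; rewrite inE negb_or => /andP[].
rewrite big_cons -muleA -IHs.
pose G := [set B | exists (r' : seq I) (E' : I -> set T), [/\ uniq r',
  (forall i, i \in r' -> F i (E' i) /\ b i = k),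
  (forall i, i \notin r' -> E' i = setT) &
  B = \bigcap_(i in [set` r']) E' i]].
apply: (@pi_lambda_independent G) => //; last 1 first.
- have : <<s block F b k >> (A k) by apply: sA; rewrite inE eqxx.
  apply: sub_smallest2r => [|B [i /= bik FB]].
    exact: smallest_sigma_algebra.
  exists [:: i], (fun i' => if i' == i then B else setT); split => //.
  + by move=> i'; rewrite inE => /eqP ->; rewrite eqxx.
  + by move=> i'; rewrite inE => /negbTE ->.
  + by rewrite set_cons1 bigcap_set1 eqxx.
- move=> _ [r' [E' [_ FE' _ ->]]].
  apply: fin_bigcap_measurable => [|i ir]; first exact: finite_seq.
  apply: (mF i).
  by have [] := FE' i ir.
- exact: measurableI.
- move=> _ _ [r1 [E1 [u1 F1 T1 ->]]] [r2 [E2 [u2 F2 T2 ->]]].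
  exists (undup (r1 ++ r2)), (fun i => E1 i `&` E2 i); split.
  + exact: undup_uniq.
  + move=> i; rewrite mem_undup mem_cat.
    have [i1|i1] := boolP (i \in r1); have [i2|i2] := boolP (i \in r2) => //= _.
    * by have [? ->] := F1 _ i1; have [? _] := F2 _ i2; split => //; exact: FI.
    * by rewrite T2// setIT; exact: F1.
    * by rewrite T1// setTI; exact: F2.
  + move=> i; rewrite mem_undup mem_cat negb_or => /andP[i1 i2].
    by rewrite T1// T2// setIT.
  + apply/seteqP; split => w.
      move=> [w1 w2] i /=; rewrite mem_undup mem_cat => _; split.
        by have [|/T1 ->//] := boolP (i \in r1) => /w1.
      by have [|/T2 ->//] := boolP (i \in r2) => /w2.
    move=> w12; split => i /= ir.
      by have [] := w12 i; rewrite //= mem_undup mem_cat ir.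
    by have [] := w12 i; rewrite //= mem_undup mem_cat ir orbT.
- exists [::], (fun=> setT); split => //.
  by rewrite set_nil bigcap_set0.
- move=> _ [r' [E' [ur' FE' TE' ->]]].
  have disj i : i \in r' -> i \notin r.
    move=> ir'; apply/negP => ir; have [_ bik] := FE' _ ir'.
    by have := rs _ ir; rewrite bik inE eqxx.
  pose EE i := if i \in r' then E' i else E i.
  have EE' i : i \in r' -> EE i = E' i by rewrite /EE => ->.
  have EEr i : i \in r -> EE i = E i.
    by rewrite /EE; case: ifPn => // /disj /negbTE ->.
  have -> : \bigcap_(i in [set` r']) E' i `&`
      (\bigcap_(k' in [set` s]) A k' `&` Es) =
      \bigcap_(k' in [set` s]) A k' `&` \bigcap_(i in [set` r' ++ r]) EE i.
    rewrite setICA; congr (_ `&` _); apply/seteqP; split => w.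
      move=> [w1 w2] i /=; rewrite mem_cat => /orP[ir|ir].
        by rewrite EE'//; exact: w1.
      by rewrite EEr//; exact: w2.
    move=> w12; split => i /= ir.
      by rewrite -EE'//; apply: w12 => /=; rewrite mem_cat ir.
    by rewrite -EEr//; apply: w12 => /=; rewrite mem_cat ir orbT.
  rewrite IH//; first last.
  + move=> i; rewrite mem_cat => /orP[ir|ir].
      by have [_ ->] := FE' _ ir.
    by have := rs _ ir; rewrite inE negb_or => /andP[].
  + move=> i; rewrite mem_cat => /orP[ir|ir].
      by rewrite EE'//; have [] := FE' _ ir.
    by rewrite EEr//; exact: FE.
  + rewrite cat_uniq ur' ur andbT /=; apply/hasPn => i ir.
    by apply/negP => /disj; rewrite ir.
  + by move=> k' k's; apply: sA; rewrite inE k's orbT.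
  have P1 : (\prod_(i <- r') Pr (EE i) = \prod_(i <- r') Pr (E' i))%E.
    by apply: eq_big_seq => i /EE' ->.
  have P2 : (\prod_(i <- r) Pr (EE i) = \prod_(i <- r) Pr (E i))%E.
    by apply: eq_big_seq => i /EEr ->.
  rewrite big_cat/= IHs P1 P2 -indF//; last by move=> i /FE'[].
  by rewrite muleCA.
Qed.

(** This is used twice: to treat all the clocks as one source of randomness,
    independent of the rest, and to treat the sites one by one. *)
Lemma independent_blocks (I K : eqType) (F : I -> set (set T)) (b : I -> K) :
  (forall i, F i `<=` measurable) -> (forall i, setI_closed (F i)) ->
  independent Pr F -> independent Pr (fun k => <<s block F b k >>).
Proof.
move=> mF FI indF s A us sA.
have := independent_blocks_aux mF FI indF us sA (r := [::]) (E := fun=> setT).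
rewrite big_nil mule1 set_nil bigcap_set0 setIT.
by move=> ->.
Qed.

End independence.

(** * Product spaces and i.i.d. exponential families *)

Section function_space.
Context (R : realType) (J : eqType).

Definition coord_events : set (set (J -> R)) :=
  [set A | exists j B, measurable B /\ A = [set f | B (f j)]].

Definition fun_space := g_sigma_algebraType coord_events.

Definition box (B : J -> set R) : set fun_space :=
  [set f | forall j, B j (f j)].

(** The constraint bears on all coordinates, but is trivial outside a finite
    list, so that boxes are intersected coordinatewise. *)
Definition boxes (G : set (set R)) : set (set fun_space) :=
  [set A | exists B (s : seq J), [/\ forall j, G (B j),
     (forall j, j \notin s -> B j = setT) & A = box B]].

Lemma measurable_coord j :
  measurable_fun [set: fun_space] (fun f : fun_space => f j).
Proof.
move=> _ B mB; rewrite setTI; apply: sub_sigma_algebra.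
by exists j, B.
Qed.

Lemma measurable_joint d (T : measurableType d) (Y : T -> fun_space) :
  (forall j, measurable_fun [set: T] (fun w => Y w j)) ->
  measurable_fun [set: T] Y.
Proof.
move=> mY; apply: (@measurability _ _ _ _ [set: T] Y coord_events) => //.
move=> _ [_ [j [B [mB ->]]] <-].
exact: mY.
Qed.

Lemma box_bigcap (B : J -> set R) (s : seq J) :
  (forall j, j \notin s -> B j = setT) ->
  box B = \bigcap_(j in [set` s]) [set f | B j (f j)].
Proof.
move=> BT; apply/seteqP; split => f /= fB; first by move=> j _; exact: fB.
move=> j; have [js|/BT ->//] := boolP (j \in s); exact: fB.
Qed.

Lemma boxes_measurable G : G `<=` measurable -> boxes G `<=` measurable.
Proof.
move=> mG _ [B [s [GB BT ->]]]; rewrite (box_bigcap BT).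
apply: fin_bigcap_measurable => // j js.
rewrite -[X in measurable X]setTI; apply: measurable_coord => //.
by apply: mG; exact: GB.
Qed.

Lemma measurable_box (B : J -> set R) (s : seq J) :
  (forall j, measurable (B j)) -> (forall j, j \notin s -> B j = setT) ->
  measurable (box B).
Proof.
by move=> mB BT; apply: (@boxes_measurable measurable) => //; exists B, s.
Qed.

Lemma measurable_boxes (G : set (set R)) : measurable = <<s G >> -> G setT ->
  (measurable : set (set fun_space)) = <<s boxes G >>.
Proof.
move=> mG GT; apply/seteqP; split; last first.
  apply: smallest_sub; first exact: sigma_algebra_measurable.
  by apply: boxes_measurable; rewrite mG; exact: sub_sigma_algebra.
apply: smallest_sub; first exact: smallest_sigma_algebra.
move=> _ [j [B [mB ->]]].
have mf : measurable_fun [set: g_sigma_algebraType (boxes G)]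
    (fun f : g_sigma_algebraType (boxes G) => (f : J -> R) j).
  apply: (@measurability _ _ _ _ _ _ G) => //.
  move=> _ [C GC <-]; rewrite setTI; apply: sub_sigma_algebra.
  exists (fun k => if k == j then C else setT), [:: j]; split.
  - by move=> k; case: ifP.
  - by move=> k; rewrite inE => /negbTE ->.
  - apply/seteqP; split => f /=.
      by move=> Cf k; case: eqP => [->|].
    by move=> /(_ j); rewrite eqxx.
by have := mf measurableT B mB; rewrite setTI.
Qed.

Lemma boxes_setI G : setI_closed G -> setI_closed (boxes G).
Proof.
move=> GI _ _ [B [s [GB BT ->]]] [C [r [GC CT ->]]].
exists (fun j => B j `&` C j), (s ++ r); split.
- by move=> j; exact: GI.
- by move=> j; rewrite mem_cat negb_or => /andP[/BT -> /CT ->]; rewrite setIT.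
- apply/seteqP; split => f; first by move=> [fB fC] j; split.
  by move=> fBC; split => j; have [] := fBC j.
Qed.

Lemma fun_space_unique (G : set (set R)) (m1 m2 : {measure set fun_space -> \bar R}) :
  measurable = <<s G >> -> setI_closed G -> G setT -> (m1 setT < +oo)%E ->
  (forall A, boxes G A -> m1 A = m2 A) ->
  forall A, measurable A -> m1 A = m2 A.
Proof.
move=> mG GI GT moo m12 A mA.
apply: (measure_unique (boxes G) (fun=> setT)) => //.
- exact: measurable_boxes.
- exact: boxes_setI.
- by move=> _; exists (fun=> setT), [::]; split => //; apply/seteqP; split.
- by rewrite bigcup_const.
Qed.

Lemma fun_space_unique_boxes (m1 m2 : {measure set fun_space -> \bar R}) :
  (m1 setT < +oo)%E ->
  (forall A, boxes measurable A -> m1 A = m2 A) ->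
  forall A, measurable A -> m1 A = m2 A.
Proof.
apply: fun_space_unique => //; last by move=> *; exact: measurableI.
by rewrite sigma_algebra_id//; exact: sigma_algebra_measurable.
Qed.

End function_space.
Arguments box {R J} B.

Section iid_exponential.
Context (R : realType).

Definition iid_exp d (T : measurableType d) (Pr : probability T R) (J : eqType)
    (y : J -> {RV Pr >-> R}) :=
  (forall j B, measurable B -> Pr (y j @^-1` B) = exponential_prob 1 B) /\
  independent Pr (fun j => sigma_RV (y j)).

Section joint.
Context d (T : measurableType d) (Pr : probability T R) (J : eqType).
Variable y : J -> {RV Pr >-> R}.

Definition joint (w : T) : fun_space R J := y ^~ w.

Lemma measurable_fun_joint : measurable_fun setT joint.
Proof. by apply: measurable_joint => j; exact: measurable_funPT. Qed.

HB.instance Definition _ := isMeasurableFun.Build _ _ _ _ joint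
  measurable_fun_joint.

Lemma iid_exp_box (B : J -> set R) (s : seq J) : iid_exp y ->
  uniq s -> (forall j, measurable (B j)) -> (forall j, j \notin s -> B j = setT) ->
  Pr (joint @^-1` box B) = (\prod_(j <- s) exponential_prob 1 (B j))%E.
Proof.
move=> [y1 yi] us mB BT.
under eq_bigr => j _ do rewrite -(y1 j (B j) (mB j)).
rewrite (box_bigcap BT) preimage_bigcap -yi//.
by move=> j _; exists (B j) => //; rewrite setTI.
Qed.

End joint.

(** Boxes generate the product sigma-algebra, and independence fixes the
    probability of every box. *)
Lemma iid_exp_joint_law d1 (T1 : measurableType d1) (Pr1 : probability T1 R)
    d2 (T2 : measurableType d2) (Pr2 : probability T2 R) (J : eqType)
    (y1 : J -> {RV Pr1 >-> R}) (y2 : J -> {RV Pr2 >-> R}) :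
  iid_exp y1 -> iid_exp y2 -> forall A, measurable A ->
  Pr1 (joint y1 @^-1` A) = Pr2 (joint y2 @^-1` A).
Proof.
move=> i1 i2 A mA.
apply: (@fun_space_unique_boxes R J (distribution Pr1 (joint y1))
  (distribution Pr2 (joint y2))) => //.
  by rewrite /= probability_setT ltry.
move=> _ [B [s [mB BT ->]]].
have BT' j : j \notin undup s -> B j = setT by rewrite mem_undup; exact: BT.
by rewrite /= /distribution/pushforward !(iid_exp_box (s := undup s))// undup_uniq.
Qed.

End iid_exponential.

(** * The exponential distribution *)

Section exponential_distribution.
Context (R : realType).
Local Notation mu := (@lebesgue_measure R).

Fact exists_expo : exists p : probability (measurableTypeR R) R,
  forall A, p A = exponential_prob 1 A.
Proof.
by exists (exponential_distribution_exponential_prob__canonical__probability_measure_Probability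
  ltr01).
Qed.

(** The choice operator keeps the measure structure of [exponential_prob 1]
    from being unfolded by simplification. *)
Definition expo : probability (measurableTypeR R) R := sval (cid exists_expo).

Lemma expoE (A : set R) : expo A = exponential_prob 1 A.
Proof. exact: (svalP (cid exists_expo)). Qed.

Let mpdf : measurable_fun setT (EFin \o (exponential_pdf 1 : R -> R)).
Proof. by apply/measurable_EFinP; exact: measurable_exponential_pdf. Qed.

Definition tail (t : R) : R := expR (- Num.max 0 t).

Lemma expo_neg : expo `]-oo, 0]%classic = 0%E.
Proof.
rewrite expoE /exponential_prob (_ : `]-oo, 0]%classic = `]-oo, 0[ `|` [set 0]).
  rewrite ge0_integral_setU//=; last 3 first.
  - exact: (measurable_funS measurableT (@subsetT _ _) mpdf).
  - by move=> x _; rewrite lee_fin exponential_pdf_ge0.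
  - by apply/disj_setPS => x [/=]; rewrite in_itv/= => x0 xE; move: x0; rewrite xE ltxx.
  rewrite integral_set1 adde0 integral0_eq// => x /=; rewrite in_itv/= => x0.
  by rewrite lt0_exponential_pdf.
apply/seteqP; split => x /=; rewrite !in_itv/= le_eqVlt.
  by move=> /orP[/eqP ->|]; [right|left].
by move=> [->|->]; rewrite ?eqxx ?orbT.
Qed.

Lemma expo_ray t : expo `]t, +oo[%classic = (tail t)%:E.
Proof.
have -> : `]t, +oo[%classic = ~` `]-oo, t] by rewrite setCitvl.
rewrite probability_setC//= /tail.
have [t0|t0] := leP t 0.
  have -> : expo `]-oo, t]%classic = 0%E.
    apply/eqP; rewrite eq_le measure_ge0 andbT -expo_neg.
    by apply: le_measure; rewrite ?inE//; apply: subset_itvl.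
  by rewrite oppr0 expR0 sube0.
have -> : (expo `]-oo, t]%classic = expo `]-oo, 0%R]%classic + expo `[0%R, t]%classic)%E.
  rewrite expo_neg add0e; apply/eqP; rewrite eq_le; apply/andP; split; last first.
    by apply: le_measure; rewrite ?inE// => x /=; rewrite !in_itv/= => /andP[].
  rewrite -[leRHS]add0e -expo_neg.
  apply: le_trans (measureU2 _ _ _) => //.
  apply: le_measure; rewrite ?inE//; first exact: measurableU.
  move=> x /=; rewrite !in_itv/= => xt.
  by have [x0|x0] := leP x 0; [left|right; rewrite (ltW x0)].
by rewrite expo_neg add0e expoE exponential_prob_itv0c// mulN1r -!EFinB subKr.
Qed.

Lemma tail_ge0 t : 0 <= tail t. Proof. exact: expR_ge0. Qed.

Lemma tail_le1 t : tail t <= 1.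
Proof. by rewrite -expR0 ler_expR oppr_le0 le_max lexx. Qed.

Lemma tail_pos t : 0 <= t -> tail t = expR (- t).
Proof. by move=> t0; rewrite /tail max_r. Qed.

Lemma tail_neg t : t <= 0 -> tail t = 1.
Proof. by move=> t0; rewrite /tail max_l// oppr0 expR0. Qed.

Lemma measurable_tail : measurable_fun [set: R] tail.
Proof.
have -> : tail = @expR R \o (-%R \o (fun t : R => Num.max 0 t)) by [].
apply: measurableT_comp; first exact: measurable_expR.
apply: measurableT_comp; first exact: oppr_measurable.
by apply: measurable_maxr => //; exact: measurable_cst.
Qed.

(** The density is a Radon-Nikodym derivative. *)
Lemma integral_expo (f : R -> R) : (forall x, 0 <= f x) -> (forall x, f x <= 1) ->
  measurable_fun setT f ->
  (\int[expo]_x (f x)%:E = \int[mu]_x (f x * exponential_pdf 1 x)%:E)%E.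
Proof.
move=> f0 f1 mf.
have fi : expo.-integrable setT (EFin \o f).
  apply/integrableP; split; first exact/measurable_EFinP.
  apply: (@le_lt_trans _ _ (\int[expo]_x (cst 1 x))%E).
    apply: ge0_le_integral => //=.
      by do 2 apply: measurableT_comp => //.
    by move=> x _; rewrite lee_fin ger0_norm.
  by rewrite integral_cst//= mul1e (le_lt_trans (probability_le1 _ _))// ltry.
have dom : expo `<< mu.
  apply/null_content_dominatesP => A mA muA0; rewrite expoE /exponential_prob.
  apply: null_set_integral => //.
  exact: (measurable_funS measurableT (@subsetT _ _) mpdf).
rewrite -(Radon_Nikodym_change_of_variables dom)//=.
apply: ae_eq_integral => //.
- apply: emeasurable_funM; first exact/measurable_EFinP.
  by apply: (measurable_int mu); exact: Radon_Nikodym_integrable.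
- under eq_fun do rewrite EFinM.
  apply: emeasurable_funM; first exact/measurable_EFinP.
  exact: mpdf.
- under [X in ae_eq _ _ _ X]eq_fun do rewrite EFinM.
  apply: ae_eqe_mul2l => /=.
  rewrite Radon_NikodymE//=.
  case: cid => /= h [h1 h2 h3].
  by apply: integral_ae_eq => //= E _ mE; rewrite -h3// expoE.
Qed.

(** If [x] is exponential and [W] is an independent exponential variable, then
    [lam * x], increased by [W] with probability [1 - lam], is exponential
    again.  The integrand is the density of rate [1] beyond [t / lam], and a
    multiple of the density of rate [1 - lam] before it, so no primitive has
    to be computed. *)
Lemma tail_convolution (lam t : R) : 0 < lam -> lam <= 1 ->
  (lam%:E * (tail (t / lam))%:E +
   (1 - lam)%:E * \int[expo]_x (tail (t - lam * x))%:E = (tail t)%:E)%E.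
Proof.
move=> lam0 lam1.
have maff : measurable_fun setT (fun x : R => tail (t - lam * x)).
  apply: (measurableT_comp measurable_tail).
  by apply: measurable_funB => //; apply: measurable_funM.
have [lamE|lamN1] := eqVneq lam 1.
  by rewrite lamE subrr mul0e adde0 mul1e divr1.
have a0 : 0 < 1 - lam by rewrite subr_gt0 lt_neqAle lamN1.
rewrite integral_expo//; [|by move=> x; exact: tail_ge0|by move=> x; exact: tail_le1].
have pdfT : (\int[mu]_x (exponential_pdf 1 x)%:E = 1)%E.
  exact: integral_exponential_pdf.
have [t0|t0] := leP t 0.
  rewrite !tail_neg//; last by rewrite pmulr_lle0// invr_gt0.
  rewrite (_ : \int[mu]_x _ = 1)%E; last first.
    rewrite -pdfT; apply: eq_integral => x _.
    have [x0|x0] := ltP x 0; first by rewrite lt0_exponential_pdf// mulr0.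
    by rewrite tail_neg ?mul1r// subr_le0 (le_trans t0)// mulr_ge0// ltW.
  by rewrite !mule1 -EFinD addrC subrK.
pose s := t / lam.
have s0 : 0 < s by rewrite divr_gt0.
have ts : t = lam * s by rewrite mulrC divfK// gt_eqF.
rewrite -/s (tail_pos (ltW s0)) (tail_pos (ltW t0)).
have g0 x : (0 <= (tail (t - lam * x) * exponential_pdf 1 x)%:E)%E.
  by rewrite lee_fin mulr_ge0 ?tail_ge0 ?exponential_pdf_ge0.
have mg : measurable_fun setT
    (EFin \o (fun x => tail (t - lam * x) * exponential_pdf 1 x) : R -> \bar R).
  apply/measurable_EFinP; apply: measurable_funM => //.
  exact: measurable_exponential_pdf.
rewrite -(setUv `[0, s]%classic) ge0_integral_setU//=; last 3 first.
- exact: measurableC.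
- by rewrite setUv.
- exact/disj_setPCl.
rewrite (_ : \int[mu]_(x in `[0%R, s]) _ =
    (expR (- t) / (1 - lam))%:E * exponential_prob (1 - lam) `[0%R, s]%classic)%E; last first.
  rewrite /exponential_prob -ge0_integralZl//=; last 3 first.
  - apply/measurable_funTS/measurable_EFinP; exact: measurable_exponential_pdf.
  - by move=> x _; rewrite lee_fin exponential_pdf_ge0// ltW.
  - by rewrite lee_fin divr_ge0 ?expR_ge0 ?ltW.
  apply: eq_integral => x; rewrite inE/= in_itv/= => /andP[x0 xs].
  rewrite -EFinM !exponential_pdfE//; congr EFin.
  rewrite tail_pos; last by rewrite subr_ge0 ts ler_pM2l.
  rewrite mul1r mulrA divfK ?gt_eqF// -!expRD; congr expR; ring.
rewrite (_ : \int[mu]_(x in ~` _) _ = expo (~` `[0%R, s]%classic))%E; last first.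
  rewrite expoE /exponential_prob.
  apply: eq_integral => x; rewrite inE/= in_itv/= => /negP.
  rewrite negb_and -!ltNge => /orP[x0|xs].
    by rewrite lt0_exponential_pdf// mulr0.
  by rewrite tail_neg ?mul1r// subr_le0 ts ler_pM2l// ltW.
rewrite probability_setC// expoE !exponential_prob_itv0c//.
rewrite -!(EFinB, EFinM, EFinD); congr EFin.
rewrite mulN1r.
have -> : expR (- s) = expR (- t) * expR (- (1 - lam) * s).
  by rewrite -expRD; congr expR; rewrite ts; ring.
by field; rewrite gt_eqF.
Qed.

(** The right-hand side contracts the supremum distance by [1 - lam]; after
    [n] steps two solutions with values in the unit interval differ by at most
    [(1 - lam) ^+ n]. *)
Lemma fixpoint_unique (lam : R) (h v w : R -> R) : 0 < lam -> lam <= 1 ->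
  (forall t, 0 <= v t <= 1) -> (forall t, 0 <= w t <= 1) ->
  (forall t, 0 <= h t) ->
  measurable_fun setT v -> measurable_fun setT w ->
  (forall t, (v t)%:E =
     (h t)%:E + (1 - lam)%:E * \int[expo]_x (v (t - lam * x))%:E)%E ->
  (forall t, (w t)%:E =
     (h t)%:E + (1 - lam)%:E * \int[expo]_x (w (t - lam * x))%:E)%E ->
  v =1 w.
Proof.
move=> lam0 lam1; move: v w.
have step (v w : R -> R) n : (forall t, 0 <= v t <= 1) -> (forall t, 0 <= w t <= 1) ->
  (forall t, 0 <= h t) ->
  measurable_fun setT v -> measurable_fun setT w ->
  (forall t, (v t)%:E =
     (h t)%:E + (1 - lam)%:E * \int[expo]_x (v (t - lam * x))%:E)%E ->
  (forall t, (w t)%:E =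
     (h t)%:E + (1 - lam)%:E * \int[expo]_x (w (t - lam * x))%:E)%E ->
  forall t, v t <= w t + (1 - lam) ^+ n.
  move=> v01 w01 h0 mv mw vE wE.
  have maff t : measurable_fun setT (fun x : R => t - lam * x).
    by apply: measurable_funB => //; apply: measurable_funM.
  elim: n => [|n IH] t.
    have /andP[_ v1] := v01 t; have /andP[w0 _] := w01 t.
    by rewrite expr0 (le_trans v1)// lerDr.
  rewrite -lee_fin EFinD vE wE -addeA leeD2l// exprS EFinM -muleDr//; last first.
    by rewrite ge0_adde_def// inE ?lee_fin ?exprn_ge0 ?subr_ge0// integral_ge0// => x _; rewrite lee_fin; case/andP: (w01 (t - lam * x)).
  apply: lee_wpmul2l; first by rewrite lee_fin subr_ge0.
  have -> : (((1 - lam) ^+ n)%:E = \int[expo]_x (cst ((1 - lam) ^+ n)%:E x))%E.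
    rewrite integral_cst//=. by rewrite probability_setT mule1.
  rewrite -ge0_integralD//=; last 3 first.
  - by move=> x _; rewrite lee_fin; case/andP: (w01 (t - lam * x)).
  - by apply/measurable_EFinP; exact: (measurableT_comp mw (maff t)).
  - by move=> x _; rewrite lee_fin exprn_ge0// subr_ge0.
  apply: ge0_le_integral => //=.
  - by move=> x _; rewrite lee_fin; case/andP: (v01 (t - lam * x)).
  - by apply/measurable_EFinP; exact: (measurableT_comp mv (maff t)).
  - apply: emeasurable_funD => //.
    by apply/measurable_EFinP; exact: (measurableT_comp mw (maff t)).
  - by move=> x _; rewrite -EFinD lee_fin.
move=> v w v01 w01 h0 mv mw vE wE.
have le_ (a b : R) : (forall n, a <= b + (1 - lam) ^+ n) -> a <= b.
  move=> ab; apply/ler_addgt0Pr => e e0.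
  have : (1 - lam) ^+ n @[n --> \oo] --> (0 : R).
    by apply: cvg_expr; rewrite ger0_norm ?subr_ge0// ltrBlDr ltrDl.
  move=> /cvgrPdist_lt /(_ e e0)[n _ /(_ n (leqnn n))] /=.
  rewrite sub0r normrN ger0_norm ?exprn_ge0 ?subr_ge0// => le.
  by rewrite (le_trans (ab n))// lerD2l ltW.
move=> t; apply/eqP; rewrite eq_le; apply/andP; split; apply: le_ => n; exact: step.
Qed.

End exponential_distribution.

(** * Sequences of independent exponential variables *)

Lemma measurable_nat_case d1 (T1 : measurableType d1) d2 (T2 : measurableType d2)
    (N : T1 -> nat) (f : nat -> T1 -> T2) :
  (forall n, measurable [set w | N w = n]) ->
  (forall n, measurable_fun setT (f n)) ->
  measurable_fun setT (fun w => f (N w) w).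
Proof.
move=> mN mf _ B mB; rewrite setTI.
rewrite (_ : _ @^-1` B = \bigcup_n ([set w | N w = n] `&` f n @^-1` B)).
  apply: bigcupT_measurable => n; apply: measurableI => //.
  by rewrite -[X in measurable X]setTI; exact: mf.
apply/seteqP; split => w; first by move=> Bw; exists (N w).
by move=> [n _ [/= <-]].
Qed.

(** The value is [0] when [b] never holds. *)
Definition first_index (b : pred nat) : nat :=
  match pselect (exists n, b n) with
  | left h => ex_minn h
  | right _ => 0
  end.

Lemma first_index_hit (b : pred nat) : (exists n, b n) -> b (first_index b).
Proof.
by move=> [n bn]; rewrite /first_index; case: pselect => [h|[]];
  [case: ex_minnP|exists n].
Qed.

Lemma first_index_before (b : pred nat) n : (n < first_index b)%N -> ~~ b n.
Proof.
rewrite /first_index; case: pselect => // h; case: ex_minnP => k _ kmin nk.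
by apply/negP => /kmin; rewrite leqNgt nk.
Qed.

Lemma first_indexE (b : pred nat) n : b n ->
  (forall k, (k < n)%N -> ~~ b k) -> first_index b = n.
Proof.
move=> bn nbk; rewrite /first_index; case: pselect => [h|[]]; last by exists n.
case: ex_minnP => k bk kmin; apply/eqP; rewrite eqn_leq kmin//= leqNgt.
by apply/negP => /nbk; rewrite bk.
Qed.

Lemma measurable_first_index d (T : measurableType d) (b : T -> pred nat) n :
  (forall k, measurable [set w | b w k]) ->
  measurable [set w | first_index (b w) = n].
Proof.
move=> mb.
have mNb k : measurable [set w | ~~ b w k].
  rewrite (_ : [set _ | _] = ~` [set w | b w k]); first exact: measurableC.
  by apply/seteqP; split => w /= /negP.
rewrite (_ : [set _ | _] =
   ([set w | b w n] `&` \bigcap_(k in `I_n) [set w | ~~ b w k]) `|`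
   (if n == 0%N then \bigcap_k [set w | ~~ b w k] else set0)).
  apply: measurableU; last by case: ifP => // _; exact: bigcapT_measurable.
  by apply: measurableI => //; exact: fin_bigcap_measurable.
apply/seteqP; split => w /=.
  move=> <-; have [ex|nob] := pselect (exists k, b w k).
    by left; split; [exact: first_index_hit|move=> l; exact: first_index_before].
  right; rewrite /first_index; case: pselect => // _ /=.
  by move=> k _ /=; apply/negP => bk; apply: nob; exists k.
move=> [[bn nbk]|]; first by apply: first_indexE => // k kn; exact: nbk.
case: eqP => // -> nbk; rewrite /first_index; case: pselect => // -[k bk].
by have := nbk k I; rewrite /= bk.
Qed.

Lemma expo_ray_unique (R : realType) (K : R)
    (m : {measure set (measurableTypeR R) -> \bar R}) :
  0 <= K ->
  (forall t, m `]t, +oo[%classic = (K * tail t)%:E) ->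
  forall B, measurable B -> m B = (K%:E * expo R B)%E.
Proof.
move=> K0 mE B mB.
pose m2 := mscale (NngNum K0) (expo R).
suff : m B = m2 B by [].
move: B mB; apply: (@measure_unique _ R (measurableTypeR R) (@RGenOInfty.G R)
  (fun k => `](- k%:R), +oo[%classic) _ _ _ _ m m2) => //.
- exact: RGenOInfty.measurableE.
- move=> _ _ [x ->] [y ->]; exists (Num.max x y).
  by apply/seteqP; split => z /=; rewrite !in_itv/= !andbT gt_max => /andP.
- by move=> k; exists (- k%:R).
- apply/seteqP; split => // x _.
  exists (Num.bound `|x|) => //=; rewrite in_itv/= andbT.
  rewrite ltrNl (le_lt_trans (ler_norm _))// normrN.
  exact: (archi_boundP (normr_ge0 x)).
- by move=> _ [x ->]; rewrite mE /= /mscale/= expo_ray EFinM.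
- by move=> k; rewrite mE ltry.
Qed.

Section sequences.
Context (R : realType).
Local Notation Omega := (fun_space R nat).

Definition sskip (k : nat) (y : Omega) : Omega := fun n => y (k + n)%N.

Definition scons (x : R) (y : Omega) : Omega :=
  fun n => if n is n'.+1 then y n' else x.

Lemma scons_sskip y : scons (y 0%N) (sskip 1 y) = y.
Proof. by apply/funext => -[]. Qed.

Lemma measurable_sskip k : measurable_fun setT (sskip k).
Proof. by apply: measurable_joint => j; exact: (measurable_coord (k + j)%N). Qed.

Lemma measurable_scons :
  measurable_fun setT (fun xy : measurableTypeR R * Omega => scons xy.1 xy.2).
Proof.
apply: measurable_joint => -[|n] /=; first exact: measurable_fst.
exact: (measurableT_comp (measurable_coord n) measurable_snd).
Qed.

Section iid_law.
Variable m : probability Omega R.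
Hypothesis m_iid : forall (B : nat -> set R) N, (forall i, measurable (B i)) ->
  (forall i, (N <= i)%N -> B i = setT) ->
  m (box B) = (\prod_(i < N) expo R (B i))%E.

Let scons_uncurried (xy : measurableTypeR R * Omega) := scons xy.1 xy.2.
HB.instance Definition _ := isMeasurableFun.Build _ _ _ _ scons_uncurried
  measurable_scons.

(** The first term is independent of the rest, which has the law of the whole
    sequence. *)
Lemma iid_scons (E : set Omega) : measurable E ->
  m E = (\int[expo R]_x m [set y | E (scons x y)])%E.
Proof.
move=> mE.
transitivity (pushforward (expo R \x m)%E scons_uncurried E); last first.
  rewrite /pushforward /product_measure1/=; apply: eq_integral => x _ /=.
  by congr (m _); apply/seteqP; split => y; rewrite /xsection/= inE.
apply: (@fun_space_unique_boxes R _ m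
  (pushforward (expo R \x m)%E scons_uncurried)) => //.
  by rewrite (le_lt_trans (probability_le1 _ _)) ?ltry.
move=> _ [B [s [mB BT ->]]].
pose N := (\max_(j <- s) j).+1.
have BN i : (N <= i)%N -> B i = setT.
  move=> Ni; apply: BT; apply/negP => /(@leq_bigmax_seq _ s xpredT id i) /(_ isT).
  by rewrite leqNgt => /negP; apply.
rewrite /= (m_iid mB BN) big_ord_recl.
rewrite -(@m_iid (fun i => B i.+1) (\max_(j <- s) j)) //; last first.
  by move=> i Ni; apply: BN.
rewrite /= /pushforward.
rewrite (_ : _ @^-1` _ = B 0%N `*` box (fun i => B i.+1)).
  rewrite product_measure1E//; first exact: mB.
  apply: (@measurable_box _ _ _ (iota 0 N)) => // j.
  rewrite mem_iota/= add0n -leqNgt => Nj.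
  by apply: BN; rewrite (leq_trans Nj).
apply/seteqP; split => -[x y] /=.
  by move=> By; split => [|i]; [exact: (By 0%N)|exact: (By i.+1)].
by move=> [Bx By] [|i] /=; [exact: Bx|exact: By].
Qed.

Lemma iid_rect (Z : set R) (F : set Omega) : measurable Z -> measurable F ->
  m [set y | Z (y 0%N) /\ F (sskip 1 y)] = (expo R Z * m F)%E.
Proof.
move=> mZ mF; rewrite iid_scons; last first.
  apply: measurableI.
    by rewrite -[X in measurable X]setTI; exact: measurable_coord.
  by rewrite -[X in measurable X]setTI; exact: measurable_sskip.
rewrite (eq_integral (fun x : measurableTypeR R => (\1_Z x)%:E * m F)%E); last first.
  move=> x _; rewrite indicE; case: (boolP (x \in Z)) => xZ.
    rewrite mul1e; congr (m _); apply/seteqP; split => y /=; first by case.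
    by move=> Fy; split => //; rewrite inE in xZ.
  rewrite mul0e -[RHS](@measure0 _ _ _ m); congr (m _).
  by apply/seteqP; split => y //= -[Zx]; move: xZ; rewrite notin_setE.
rewrite ge0_integralZr//; last first.
  by apply/measurable_EFinP; exact: measurable_indic.
by rewrite integral_indic// setIT.
Qed.

End iid_law.
End sequences.

Lemma joint_iid d (T : measurableType d) (R : realType) (Pr : probability T R)
    (y : nat -> {RV Pr >-> R}) : iid_exp y -> forall (B : nat -> set R) N, (forall i, measurable (B i)) ->
  (forall i, (N <= i)%N -> B i = setT) ->
  distribution Pr (joint y) (box B) = (\prod_(i < N) expo R (B i))%E.
Proof.
move=> y_iid B N mB BT; rewrite /= /distribution/pushforward (iid_exp_box (s := iota 0 N) y_iid)//.
- by rewrite -[N in iota _ N]subn0 -/(index_iota _ _) big_mkord;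
    apply: eq_bigr => i _; rewrite expoE.
- exact: iota_uniq.
- by move=> n; rewrite mem_iota/= add0n -leqNgt; exact: BT.
Qed.

(** * Thinning a marked sequence *)

Section thinning.
Context (R : realType) (lam : R).
Local Notation Omega := (fun_space R nat).

(** Even coordinates are waiting times, odd ones are marks; the thinned
    sequence has the same format.  An exponential mark exceeds the threshold
    with probability [lam]. *)
Definition threshold : R := - ln lam.

Definition success (y : Omega) (n : nat) : bool := threshold < y n.*2.+1.

Definition first_success (y : Omega) : nat := first_index (success y).

Definition waiting (y : Omega) : R :=
  lam * \sum_(i < (first_success y).+1) y i.*2.

Definition residual (y : Omega) : R := y (first_success y).*2.+1 - threshold.

Definition after_success (y : Omega) : Omega := sskip (first_success y).+1.*2 y.

Definition thin (y : Omega) : Omega := fun n =>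
  let z := iter n./2 after_success y in
  if odd n then residual z else waiting z.

Definition infinitely_many (y : Omega) :=
  forall k, exists2 n, (k <= n)%N & success y n.

Lemma thin_scons y : thin y =
  scons (waiting y) (scons (residual y) (thin (after_success y))).
Proof.
apply/funext => -[//|[//|n]]; rewrite /thin /= negbK -iterSr.
by [].
Qed.

Lemma success_first y : infinitely_many y -> success y (first_success y).
Proof. by move=> /(_ 0%N)[n _ sn]; apply: first_index_hit; exists n. Qed.

Lemma success_sskip y k n : success (sskip k.*2 y) n = success y (k + n)%N.
Proof. by rewrite /success /sskip doubleD addnS. Qed.

Lemma infinitely_many_sskip y k :
  infinitely_many (sskip k.*2 y) <-> infinitely_many y.
Proof.
split=> yi n.
  have [l nl sl] := yi n; exists (k + l)%N; last by rewrite -success_sskip.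
  by rewrite (leq_trans nl)// leq_addl.
have [l nl sl] := yi (k + n)%N; exists (l - k)%N.
  by rewrite leq_subRL// (leq_trans _ nl)// leq_addr.
by rewrite success_sskip subnKC// (leq_trans _ nl)// leq_addr.
Qed.

Lemma infinitely_many_scons x z y :
  infinitely_many (scons x (scons z y)) = infinitely_many y.
Proof. by apply/propext; rewrite -(infinitely_many_sskip (scons x (scons z y)) 1). Qed.

(** The effect of thinning when a waiting time [x] and a mark [z] are put in
    front of a sequence: a success starts anew with [y], whereas a failure only
    adds [lam * x] to the first waiting time. *)
Section recursion.
Variables (x z : R) (y : Omega).
Local Notation y' := (scons x (scons z y)).

Lemma first_success_now : threshold < z -> first_success y' = 0%N.
Proof. by move=> zs; apply: first_indexE. Qed.

Lemma first_success_later : z <= threshold -> infinitely_many y ->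
  first_success y' = (first_success y).+1.
Proof.
move=> zs yi; apply: first_indexE; first exact: success_first.
move=> [_|k]; first by rewrite /success /= -leNgt.
by rewrite ltnS => /first_index_before.
Qed.

Lemma waiting_now : threshold < z -> waiting y' = lam * x.
Proof. by move=> zs; rewrite /waiting first_success_now// big_ord1. Qed.

Lemma residual_now : threshold < z -> residual y' = z - threshold.
Proof. by move=> zs; rewrite /residual first_success_now. Qed.

Lemma after_success_now : threshold < z -> after_success y' = y.
Proof. by move=> zs; rewrite /after_success first_success_now. Qed.

Lemma waiting_later : z <= threshold -> infinitely_many y ->
  waiting y' = lam * x + waiting y.
Proof.
move=> zs yi; rewrite /waiting first_success_later// big_ord_recl mulrDr.
by congr (_ + _ * _); apply: eq_bigr => i _; rewrite /= doubleS.
Qed.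

Lemma residual_later : z <= threshold -> infinitely_many y ->
  residual y' = residual y.
Proof. by move=> zs yi; rewrite /residual first_success_later. Qed.

Lemma after_success_later : z <= threshold -> infinitely_many y ->
  after_success y' = after_success y.
Proof. by move=> zs yi; rewrite /after_success first_success_later. Qed.

End recursion.

Let mcoord (A : set R) n : measurable A -> measurable [set y : Omega | A (y n)].
Proof.
by move=> mA; rewrite -[X in measurable X]setTI; exact: (measurable_coord n).
Qed.

Lemma measurable_success n : measurable [set y : Omega | success y n].
Proof.
rewrite (_ : [set y : Omega | success y n] =
    [set y : Omega | `]threshold, +oo[%classic (y n.*2.+1)]); first exact: mcoord.
by apply/seteqP; split => y; rewrite /success /= in_itv/= andbT.
Qed.

Lemma measurable_first_success n : measurable [set y : Omega | first_success y = n].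
Proof. by apply: measurable_first_index; exact: measurable_success. Qed.

Lemma measurable_waiting : measurable_fun setT waiting.
Proof.
apply: (measurable_nat_case (f := fun n (y : Omega) => lam * \sum_(i < n.+1) y i.*2)).
  exact: measurable_first_success.
move=> n; apply: measurable_funM => //.
by apply: measurable_sum => i; exact: (measurable_coord i.*2).
Qed.

Lemma measurable_residual : measurable_fun setT residual.
Proof.
apply: (measurable_nat_case (f := fun n (y : Omega) => y n.*2.+1 - threshold)).
  exact: measurable_first_success.
by move=> n; apply: measurable_funB => //; exact: (measurable_coord n.*2.+1).
Qed.

Lemma measurable_after_success : measurable_fun setT after_success.
Proof.
apply: (measurable_nat_case (f := fun n => @sskip R n.+1.*2)).
  exact: measurable_first_success.
by move=> n; exact: measurable_sskip.
Qed.

Lemma measurable_thin : measurable_fun setT thin.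
Proof.
apply: measurable_joint => n; rewrite /thin.
have mit k : measurable_fun setT (iter k after_success).
  elim: k => [|k IH]; first exact: measurable_id.
  by rewrite (_ : iter _ _ = after_success \o iter k after_success)//;
    exact: (measurableT_comp measurable_after_success).
case: (odd n).
  exact: (measurableT_comp measurable_residual).
exact: (measurableT_comp measurable_waiting).
Qed.

HB.instance Definition _ := isMeasurableFun.Build _ _ _ _ waiting measurable_waiting.
HB.instance Definition _ := isMeasurableFun.Build _ _ _ _ residual measurable_residual.
HB.instance Definition _ := isMeasurableFun.Build _ _ _ _ thin measurable_thin.

Lemma measurable_infinitely_many : measurable [set y | infinitely_many y].
Proof.
rewrite (_ : [set _ | _] =
    \bigcap_k \bigcup_(n in [set n | (k <= n)%N]) [set y : Omega | success y n]).
  apply: bigcapT_measurable => k; apply: bigcup_measurable => n _.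
  exact: measurable_success.
apply/seteqP; split => y yi.
  by move=> k _; have [n kn sn] := yi k; exists n.
by move=> k; have [n kn sn] := yi k I; exists n.
Qed.

End thinning.

(** * Thinning preserves the law *)

Section renewal.
Context (R : realType) (lam : R).
Local Notation Omega := (fun_space R nat).
Hypotheses (lam0 : 0 < lam) (lam1 : lam <= 1).
Variable m : probability Omega R.
Hypothesis m_iid : forall (B : nat -> set R) N, (forall i, measurable (B i)) ->
  (forall i, (N <= i)%N -> B i = setT) ->
  m (box B) = (\prod_(i < N) expo R (B i))%E.

Local Notation threshold := (threshold lam).
Local Notation infinitely_many := (infinitely_many lam).
Local Notation success := (success lam).

Lemma threshold_ge0 : 0 <= threshold.
Proof. by rewrite /threshold oppr_ge0 ln_le0. Qed.

Lemma tail_threshold d : tail (threshold + Num.max 0 d) = lam * tail d.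
Proof.
rewrite tail_pos; last by rewrite addr_ge0 ?threshold_ge0// le_max lexx.
by rewrite opprD expRD opprK lnK.
Qed.

Lemma tail_threshold0 : tail threshold = lam.
Proof. by rewrite tail_pos ?threshold_ge0// opprK lnK. Qed.

Lemma expo_failure : expo R `]-oo, threshold]%classic = (1 - lam)%:E.
Proof.
by rewrite -(setCitvr (BRight threshold)) probability_setC// expo_ray tail_threshold0.
Qed.

Let mskip (F : set Omega) k : measurable F -> measurable [set y | F (sskip k y)].
Proof.
by move=> mF; rewrite -[X in measurable X]setTI; exact: measurable_sskip.
Qed.

Let m_skip1 (F : set Omega) : measurable F -> m [set y | F (sskip 1 y)] = m F.
Proof.
move=> mF; rewrite -[RHS]mul1e -(@probability_setT _ _ _ (expo R)).
rewrite -(iid_rect m_iid)//; congr (m _).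
by apply/seteqP; split => y /=; [|case].
Qed.

Let mfailure k : measurable [set y | forall n, (k <= n)%N -> ~~ success y n].
Proof.
rewrite (_ : [set _ | _] =
    \bigcap_(n in [set n | (k <= n)%N]) ~` [set y : Omega | success y n]).
  apply: bigcap_measurableType => n _; apply: measurableC.
  exact: measurable_success.
apply/seteqP; split => y /=.
  by move=> nsy n /= kn; apply/negP; exact: nsy.
by move=> nsy n kn; apply/negP; exact: nsy.
Qed.

(** The probability [p] of no success at all satisfies [p = (1 - lam) * p]. *)
Lemma infinitely_many_ae : {ae m, forall y, infinitely_many y}.
Proof.
pose F k := [set y : Omega | forall n, (k <= n)%N -> ~~ success y n].
have F0 : m (F 0%N) = 0%E.
  pose G := [set y : Omega | `]-oo, threshold]%classic (y 0%N) /\ F 0%N (sskip 1 y)].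
  have mG : measurable G.
    apply: measurableI; last exact: (mskip 1 (mfailure 0)).
    by rewrite -[X in measurable X]setTI; exact: (measurable_coord 0%N).
  have : m (F 0%N) = ((1 - lam)%:E * m (F 0%N))%E.
    rewrite -expo_failure -(iid_rect m_iid)//; last exact: mfailure.
    rewrite -(m_skip1 mG); congr (m _); apply/seteqP; split => y /=.
      move=> Fy; split => [|n _]; first by rewrite /= in_itv/= leNgt; exact: (Fy 0%N).
      exact: (Fy n.+1).
    move=> [y1 Fy] [_|n _]; last exact: (Fy n).
    by move: y1; rewrite /= in_itv/= leNgt.
  have := fin_num_measure m _ (mfailure 0).
  rewrite -/(F 0%N) => /fineK <-; move: (fine _) => r /eqP.
  rewrite -EFinM eqe mulrBl mul1r -subr_eq0 opprB addrC subrK mulf_eq0.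
  by rewrite (gt_eqF lam0)/= => /eqP ->.
have Fk k : m (F k) = 0%E.
  elim: k => [//|k IH]; rewrite -IH -(m_skip1 (mfailure k)).
  rewrite -(m_skip1 (mskip 1 (mfailure k))).
  congr (m _); apply/seteqP; split => y /= Fy n kn.
    exact: (Fy n.+1).
  case: n kn => // n kn; exact: (Fy n).
apply: (@negligibleS _ _ _ m (\bigcup_k F k)).
  move=> y /= nyi; apply: contrapT => nF; apply: nyi => k.
  apply: contrapT => nk; apply: nF; exists k => // n kn.
  by apply/negP => sn; apply: nk; exists n.
apply: negligible_bigcup => k; apply/(negligibleP m (mfailure k)); exact: Fk.
Qed.

Lemma m_infinitely (E : set Omega) : measurable E ->
  m (E `&` [set y | infinitely_many y]) = m E.
Proof.
move=> mE; apply: ae_eq_measure => //.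
  by apply: measurableI => //; exact: measurable_infinitely_many.
by apply: filterS infinitely_many_ae => y yi; split => [[]|].
Qed.

Section one_renewal.
Variables (d : R) (E : set Omega).
Hypothesis mE : measurable E.

Let V (t : R) : set Omega := [set y | [/\ infinitely_many y,
  t < waiting lam y, d < residual lam y & E (after_success lam y)]].

Let W : set (measurableTypeR R * Omega) := [set ty | V ty.1 ty.2].

Let mW : measurable W.
Proof.
have mX (f : measurableTypeR R * Omega -> R) : measurable_fun setT f ->
    measurable [set ty | 0 < f ty].
  move=> mf; rewrite (_ : [set _ | _] = f @^-1` `]0, +oo[%classic).
    by rewrite -[X in measurable X]setTI; exact: mf.
  by apply/seteqP; split => ty; rewrite /= in_itv/= andbT.
have m2 : measurable_fun setT (@snd (measurableTypeR R) Omega).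
  exact: measurable_snd.
rewrite (_ : W = snd @^-1` [set y | infinitely_many y] `&`
   ([set ty | 0 < waiting lam ty.2 - ty.1] `&`
   ([set ty | 0 < residual lam ty.2 - d] `&`
    snd @^-1` (after_success lam @^-1` E)))); last first.
  by apply/seteqP; split => -[t y]; rewrite /W/V/= !subr_gt0; [case|move=> [? [? []]]].
apply: measurableI.
  rewrite -[X in measurable X]setTI; apply: m2 => //.
  exact: measurable_infinitely_many.
apply: measurableI.
  apply: mX; apply: measurable_funB; last exact: measurable_fst.
  exact: (measurableT_comp (measurable_waiting lam) m2).
apply: measurableI.
  apply: mX; apply: measurable_funB => //.
  exact: (measurableT_comp (measurable_residual lam) m2).
rewrite -[X in measurable X]setTI; apply: m2 => //.
by rewrite -[X in measurable X]setTI; exact: measurable_after_success.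
Qed.

Let mV t : measurable (V t).
Proof.
rewrite (_ : V t = xsection W t); first exact: measurable_xsection.
by apply/seteqP; split => y; rewrite /xsection/= inE.
Qed.

(** The first mark either is a success, which ends the waiting time, or is a
    failure, after which the sequence starts afresh. *)
Let V_step t x : m [set y | V t (scons x y)] =
  ((\1_(`]t / lam, +oo[%classic) x)%:E * (lam * tail d * fine (m E))%:E +
   (1 - lam)%:E * m (V (t - lam * x)))%E.
Proof.
pose Zs : set R := if t < lam * x then `]threshold + Num.max 0 d, +oo[%classic else set0.
pose EI := E `&` [set y | infinitely_many y].
have mEI : measurable EI.
  by apply: measurableI => //; exact: measurable_infinitely_many.
have mZs : measurable Zs by rewrite /Zs; case: ifP.
have mrect (Z : set R) (F : set Omega) : measurable Z -> measurable F ->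
    measurable [set y : Omega | Z (y 0%N) /\ F (sskip 1 y)].
  move=> mZ mF; apply: measurableI; last exact: mskip.
  by rewrite -[X in measurable X]setTI; exact: (measurable_coord 0%N).
rewrite (_ : [set y | V t (scons x y)] =
    [set y | Zs (y 0%N) /\ EI (sskip 1 y)] `|`
    [set y | `]-oo, threshold]%classic (y 0%N) /\ V (t - lam * x) (sskip 1 y)]);
  last first.
  apply/seteqP; split => y.
    rewrite /= -{1}(scons_sskip y) /V /= infinitely_many_scons.
    have [ys|ys] := ltP threshold (y 0%N).
      rewrite waiting_now// residual_now// after_success_now//.
      move=> [yi tx dy Ey]; left; split; last by split.
      by rewrite /Zs tx /= in_itv/= andbT -ltrBrDl gt_max dy subr_gt0 ys.
    move=> [yi]; rewrite waiting_later// residual_later// after_success_later//.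
    move=> tx dy Ey; right; split; first by rewrite in_itv.
    by split => //; rewrite ltrBlDl.
  move=> H; rewrite /= -(scons_sskip y) /V /= infinitely_many_scons; move: H => -[[]|[]].
    rewrite /Zs; case: ifP => //= tx; rewrite in_itv/= andbT => ys [Ey yi].
    have ys' : threshold < y 0%N.
      by rewrite (le_lt_trans _ ys)// lerDl le_max lexx.
    rewrite waiting_now// residual_now// after_success_now//; split => //.
    by move: ys; rewrite -ltrBrDl gt_max => /andP[].
  rewrite /= in_itv/= => ys [yi tx dy Ey].
  rewrite waiting_later// residual_later// after_success_later//; split => //.
  by rewrite -ltrBlDl.
rewrite measureU; [|exact: mrect|exact: mrect|]; last first.
  apply/seteqP; split => // y /= [[ys _] [yf _]].
  move: ys yf; rewrite /Zs; case: ifP => //= _; rewrite !in_itv/= andbT.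
  move=> ys; rewrite leNgt => /negP; apply.
  by rewrite (le_lt_trans _ ys)// lerDl le_max lexx.
have mF : measurable (`]-oo, threshold]%classic : set R) by [].
transitivity (expo R Zs * m EI +
    expo R `]-oo, threshold]%classic * m (V (t - lam * x)))%E.
  exact: (congr2 adde (iid_rect m_iid mZs mEI) (iid_rect m_iid mF (mV _))).
rewrite expo_failure.
congr (_ + _)%E.
rewrite m_infinitely// indicE (_ : (x \in _) = (t < lam * x)); last first.
  by rewrite mem_setE in_itv/= andbT ltr_pdivrMr// mulrC.
rewrite /Zs; case: ifP => _; last by rewrite measure0 !mul0e.
rewrite expo_ray tail_threshold mul1e [in RHS]EFinM fineK//.
exact: fin_num_measure.
Qed.

Let v t : R := fine (m (V t)).

Let vE t : (v t)%:E = m (V t).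
Proof. by rewrite fineK// fin_num_measure. Qed.

(** As a function of [t] the left-hand side solves the fixpoint equation read
    off [V_step], which the exponential tail also solves. *)
Lemma renewal_ray t :
  m [set y | [/\ infinitely_many y, t < waiting lam y,
    d < residual lam y & E (after_success lam y)]] =
  (tail t * (tail d * fine (m E)))%:E.
Proof.
pose K := tail d * fine (m E).
have K0 : 0 <= K by rewrite mulr_ge0 ?tail_ge0// fine_ge0.
have K1 : K <= 1.
  rewrite mulr_ile1 ?tail_ge0 ?tail_le1 ?fine_ge0//.
  by rewrite -lee_fin fineK ?fin_num_measure// probability_le1.
have mv : measurable_fun setT v.
  rewrite (_ : v = fine \o (m \o xsection W)).
    apply: measurableT_comp => //.
    exact: (@measurable_fun_xsection _ _ _ _ _ m).
  apply/funext => t' /=; rewrite /v; congr (fine (m _)).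
  by apply/seteqP; split => y; rewrite /xsection/= inE.
rewrite -/(V t) -vE -/K; congr EFin.
apply: (@fixpoint_unique R lam (fun t => lam * tail (t / lam) * K) v
  (fun t => tail t * K)) => //.
- move=> t'; rewrite {1}/v fine_ge0//=; rewrite -lee_fin vE.
  exact: (probability_le1 _ (mV t')).
- move=> t'; rewrite mulr_ge0 ?tail_ge0//= mulr_ile1 ?tail_ge0 ?tail_le1//.
- by move=> t'; rewrite mulr_ge0// mulr_ge0 ?tail_ge0// ltW.
- by apply: measurable_funM => //; exact: measurable_tail.
- move=> t'; rewrite vE (iid_scons m_iid)//.
  under eq_integral do rewrite V_step -vE.
  rewrite ge0_integralD//=; last 4 first.
  + by move=> x _; rewrite mule_ge0// lee_fin// !mulr_ge0 ?tail_ge0 ?fine_ge0// ltW.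
  + by apply/measurable_EFinP; apply: measurable_funM.
  + by move=> x _; rewrite mule_ge0// lee_fin ?subr_ge0// fine_ge0.
  + apply/measurable_EFinP; apply: measurable_funM => //.
    apply: (measurableT_comp mv).
    by apply: measurable_funB => //; apply: measurable_funM.
  rewrite ge0_integralZr//=; last 2 first.
  + by apply/measurable_EFinP; exact: measurable_indic.
  + by rewrite lee_fin !mulr_ge0 ?tail_ge0 ?fine_ge0// ltW.
  rewrite [X in (X * _)%E](_ : _ = (tail (t' / lam))%:E); last first.
    by rewrite -expo_ray integral_indic// setIT.
  rewrite ge0_integralZl//=; last 3 first.
  + apply/measurable_EFinP; apply: (measurableT_comp mv).
    by apply: measurable_funB => //; apply: measurable_funM.
  + by move=> x _; rewrite lee_fin fine_ge0.
  + by rewrite lee_fin subr_ge0.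
  by congr (_ + _)%E; rewrite -EFinM /K; congr EFin; ring.
- move=> t'.
  rewrite EFinM -(tail_convolution t' lam0 lam1) muleDl//.
  rewrite -!EFinM; congr (_ + _)%E.
  rewrite -muleA; congr (_ * _)%E.
  rewrite -ge0_integralZr//=.
  + apply/measurable_EFinP; apply: (measurableT_comp (@measurable_tail R)).
    by apply: measurable_funB => //; apply: measurable_funM.
  + by move=> x _; rewrite lee_fin tail_ge0.
Qed.

End one_renewal.

(** Rays determine a finite measure on the real line. *)
Let restricted_law (f : Omega -> R) (H : set Omega) (K : R) :
  measurable_fun setT f -> measurable H -> 0 <= K ->
  (forall t, m [set y | t < f y /\ H y] = (K * tail t)%:E) ->
  forall B, measurable B -> m [set y | B (f y) /\ H y] = (K%:E * expo R B)%E.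
Proof.
move=> mf mH K0 HK B mB.
pose F : {mfun Omega >-> measurableTypeR R} :=
  HB.pack f (isMeasurableFun.Build _ _ Omega (measurableTypeR R) f mf).
rewrite -(expo_ray_unique (m := pushforward (mrestr m mH) F) K0) //= => t.
rewrite -HK /pushforward /mrestr; congr (m _).
by apply/seteqP; split => y; rewrite /= in_itv/= andbT.
Qed.

(** Rays are replaced by arbitrary sets one coordinate at a time. *)
Lemma renewal (B0 B1 : set R) (E : set Omega) :
  measurable B0 -> measurable B1 -> measurable E ->
  m [set y | [/\ B0 (waiting lam y), B1 (residual lam y) & E (after_success lam y)]] =
  (expo R B0 * (expo R B1 * m E))%E.
Proof.
move=> mB0 mB1 mE.
have mI := measurable_infinitely_many lam.
have mw B : measurable B -> measurable (waiting lam @^-1` B).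
  by move=> mB; rewrite -[X in measurable X]setTI; exact: measurable_waiting.
have mr B : measurable B -> measurable (residual lam @^-1` B).
  by move=> mB; rewrite -[X in measurable X]setTI; exact: measurable_residual.
have ma : measurable (after_success lam @^-1` E).
  by rewrite -[X in measurable X]setTI; exact: measurable_after_success.
have step1 d : m [set y | B0 (waiting lam y) /\
    [/\ infinitely_many y, d < residual lam y & E (after_success lam y)]] =
    ((tail d * fine (m E))%:E * expo R B0)%E.
  apply: (restricted_law (H := [set y | [/\ infinitely_many y,
      d < residual lam y & E (after_success lam y)]])) => //.
  - rewrite (_ : [set _ | _] = [set y | infinitely_many y] `&`
        ((residual lam @^-1` `]d, +oo[%classic) `&` (after_success lam @^-1` E))).
      by apply: measurableI => //; apply: measurableI => //; exact: mr.
    by apply/seteqP; split => y /=; rewrite in_itv/= andbT; [case|move=> [? []]].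
  - by rewrite mulr_ge0 ?tail_ge0 ?fine_ge0.
  - move=> t; rewrite mulrC -renewal_ray//; congr (m _).
    by apply/seteqP; split => y /=; [move=> [? []]|case].
have step2 : m [set y | B1 (residual lam y) /\
    [/\ infinitely_many y, B0 (waiting lam y) & E (after_success lam y)]] =
    ((fine (expo R B0) * fine (m E))%:E * expo R B1)%E.
  apply: (restricted_law (H := [set y | [/\ infinitely_many y,
      B0 (waiting lam y) & E (after_success lam y)]])) => //.
  - rewrite (_ : [set _ | _] = [set y | infinitely_many y] `&`
        ((waiting lam @^-1` B0) `&` (after_success lam @^-1` E))).
      by apply: measurableI => //; apply: measurableI => //; exact: mw.
    by apply/seteqP; split => y /=; [case|move=> [? []]].
  - by rewrite mulr_ge0 ?fine_ge0.
  - move=> t; transitivity ((tail t * fine (m E))%:E * expo R B0)%E.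
      rewrite -step1; congr (m _).
      by apply/seteqP; split => y /=; [move=> [? []]|move=> [? []]].
    rewrite -(fineK (fin_num_measure (expo R) _ mB0)) -EFinM; congr EFin.
    ring.
have -> : (expo R B0 * (expo R B1 * m E) =
    (fine (expo R B0) * fine (m E))%:E * expo R B1)%E.
  rewrite EFinM !fineK ?fin_num_measure// -muleA; congr (_ * _)%E.
  by rewrite muleC.
rewrite -step2.
transitivity (m ([set y | [/\ B0 (waiting lam y), B1 (residual lam y) &
    E (after_success lam y)]] `&` [set y | infinitely_many y])).
  rewrite m_infinitely//.
  rewrite (_ : [set _ | _] = (waiting lam @^-1` B0) `&`
        ((residual lam @^-1` B1) `&` (after_success lam @^-1` E))).
    by apply: measurableI; [exact: mw|apply: measurableI => //; exact: mr].
  by apply/seteqP; split => y /=; [case|move=> [? []]].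
by congr (m _); apply/seteqP; split => y /=; [case=> -[]|case=> ? []].
Qed.

(** By renewal the first two coordinates of the thinned sequence are
    independent of the others, which are the thinning of a sequence of the same
    law; so boxes are treated by induction on their length. *)
Lemma thin_preserves_law (A : set Omega) : measurable A ->
  m (thin lam @^-1` A) = m A.
Proof.
move=> mA; apply: (@fun_space_unique_boxes R _ (pushforward m (thin lam)) m) => //.
  by rewrite /= /pushforward preimage_setT probability_setT ltry.
move=> _ [B [s [mB BT ->]]].
have : forall i, ((\max_(j <- s) j).+1.*2 <= i)%N -> B i = setT.
  move=> i Ni; apply: BT; apply/negP => /(@leq_bigmax_seq _ s xpredT id i) /(_ isT).
  rewrite leqNgt => /negP; apply.
  by rewrite (leq_trans _ Ni)// -addnn ltn_addr.
move: (_.+1) => N; rewrite /= /pushforward.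
elim: N B mB {BT} => [|N IH] B mB BT.
  have -> : box B = setT by apply/seteqP; split => // y _ i; rewrite BT.
  by rewrite preimage_setT.
pose B' i := B i.+2.
have mB' i : measurable (B' i) by exact: mB.
have BT' i : (N.*2 <= i)%N -> B' i = setT by move=> Ni; apply: BT; rewrite doubleS.
have mboxB' : measurable (box B' : set Omega).
  apply: (@measurable_box _ _ _ (iota 0 N.*2)) => // j.
  by rewrite mem_iota/= add0n -leqNgt; exact: BT'.
transitivity (expo R (B 0%N) * (expo R (B 1%N) * m (box B')))%E.
  rewrite -IH// -renewal//; last first.
    by rewrite -[X in measurable X]setTI; exact: measurable_thin.
  congr (m _); apply/seteqP; split => y /=.
    rewrite thin_scons => By; split; [exact: (By 0%N)|exact: (By 1%N)|].
    by move=> i; exact: (By i.+2).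
  move=> [y0 y1 By]; rewrite thin_scons => -[|[|i]]; [exact: y0|exact: y1|exact: (By i)].
by rewrite (m_iid mB BT) doubleS !big_ord_recl -(m_iid mB' BT').
Qed.

End renewal.

(** * Thinning the clocks of all sites *)

Section driven_family.
Context d (T : measurableType d) (R : realType) (Pr : probability T R).

Lemma sigma_joint (J : eqType) (y : J -> {RV Pr >-> R}) (A : set (fun_space R J)) :
  measurable A -> <<s \bigcup_j sigma_RV (y j) >> (joint y @^-1` A).
Proof.
move=> mA; pose G := \bigcup_j sigma_RV (y j).
have mj : measurable_fun [set: g_sigma_algebraType G]
    (joint y : g_sigma_algebraType G -> fun_space R J).
  apply: measurable_joint => j _ B mB; rewrite setTI.
  by apply: sub_sigma_algebra; exists j => //; exists B => //; rewrite setTI.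
by have := mj measurableT A mA; rewrite setTI.
Qed.

Context (L : countType) (F0 : set (set T)).

Definition driver (y : nat * L -> {RV Pr >-> R}) (i : unit + nat * L) :=
  match i with inl _ => F0 | inr p => sigma_RV (y p) end.

Definition exp_driver (y : nat * L -> {RV Pr >-> R}) :=
  (forall p B, measurable B -> Pr (y p @^-1` B) = expo R B) /\
  independent Pr (driver y).

Hypotheses (mF0 : F0 `<=` measurable) (F0I : setI_closed F0).

Variables (lam : R) (y : nat * L -> {RV Pr >-> R}).
Hypotheses (lam0 : 0 < lam) (lam1 : lam <= 1) (y_exp : exp_driver y).

Let column (j : L) : T -> fun_space R nat := joint (fun n => y (n, j)).

Let thinned_fun (p : nat * L) (w : T) : R := thin lam (column p.2 w) p.1.

Let measurable_thinned p : measurable_fun setT (thinned_fun p).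
Proof.
exact: (measurableT_comp (measurable_coord p.1)
  (measurableT_comp (measurable_thin lam)
    (measurable_fun_joint (fun n => y (n, p.2))))).
Qed.

Definition thinned (p : nat * L) : {RV Pr >-> R} :=
  HB.pack (thinned_fun p)
    (isMeasurableFun.Build _ _ _ _ (thinned_fun p) (measurable_thinned p)).

Lemma thinnedE n j w : thinned (n, j) w = thin lam (fun k => y (k, j) w) n.
Proof. by []. Qed.

Let thin_column (j : L) (A : set (fun_space R nat)) : measurable A ->
  Pr (column j @^-1` (thin lam @^-1` A)) = Pr (column j @^-1` A).
Proof.
move=> mA.
apply: (@thin_preserves_law R lam lam0 lam1 (distribution Pr (joint (fun n => y (n, j))))) => //.
apply: joint_iid; have [y1 yi] := y_exp.
split=> [n C mC|]; first by rewrite y1// expoE.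
apply: (independent_sub (phi := fun n => inr (n, j)) _ _ yi) => [|n] //.
by move=> n k [].
Qed.

(** Thinning acts on each site separately and preserves the law of a site.
    Sites being independent, a finite intersection of thinned events has the
    probability of the corresponding intersection before thinning, and so
    inherits the product rule. *)
Lemma exp_driver_thinned : exp_driver thinned.
Proof.
have mcoord n (B : set R) : measurable B -> measurable [set f : fun_space R nat | B (f n)].
  by move=> mB; rewrite -[X in measurable X]setTI; exact: measurable_coord.
have [y1 yi] := y_exp.
have Pr1 p (B : set R) : measurable B -> Pr (thinned p @^-1` B) = Pr (y p @^-1` B).
  by case: p => n j mB; rewrite -[RHS](thin_column j (mcoord n B mB)).
split=> [p B mB|]; first by rewrite Pr1// y1.
move=> s E us FE.
have /choice[B BP] (p : nat * L) : exists B : set R, measurable B /\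
    (inr p \in s -> E (inr p) = thinned p @^-1` B).
  have [ps|ps] := boolP (inr p \in s); last by exists setT; split.
  by have [B mB <-] := FE _ ps; exists B; split => //; rewrite setTI.
pose E' i := match i with inl _ => E i | inr p => y p @^-1` B p end.
pose b (i : unit + nat * L) := match i with inl _ => None | inr p => Some p.2 end.
pose A (E0 : unit + nat * L -> set T) (k : option L) :=
  \bigcap_(i in [set i | i \in s /\ b i = k]) E0 i.
(* The events are grouped by site, the initial event being a block apart. *)
pose ks := undup (map b s).
have AE E0 : \bigcap_(i in [set` s]) E0 i = \bigcap_(k in [set` ks]) A E0 k.
  apply/seteqP; split => w Ew; first by move=> k _ i [/= si _]; exact: Ew.
  by move=> i si; apply: (Ew (b i)) => //=; rewrite mem_undup map_f.
pose Rj j : set (fun_space R nat) :=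
  \bigcap_(n in [set n | inr (n, j) \in s]) [set f | B (n, j) (f n)].
have mRj j : measurable (Rj j).
  by apply: bigcap_measurableType => n _; apply: mcoord; have [] := BP (n, j).
have AS j : A E (Some j) = column j @^-1` (thin lam @^-1` Rj j).
  apply/seteqP; split => w Aw.
    move=> n /= njs; have [_ /(_ njs) Enj] := BP (n, j).
    by have : E (inr (n, j)) w by [apply: Aw; split]; rewrite Enj.
  move=> -[u|[n j']] [//= njs [jE]]; rewrite jE in njs *.
  by have [_ ->//] := BP (n, j); exact: Aw.
have A'S j : A E' (Some j) = column j @^-1` (Rj j).
  apply/seteqP; split => w Aw.
    by move=> n /= njs; exact: (Aw (inr (n, j))).
  move=> -[u|[n j']] [//= njs [jE]]; rewrite jE in njs *.
  exact: Aw.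
have AN : A E None = A E' None.
  by apply/seteqP; split => w Aw [u|p] [si] //= _; apply: (Aw (inl u)).
have PrA k : Pr (A E k) = Pr (A E' k).
  by case: k => [j|]; rewrite ?AN// AS A'S thin_column.
have mdr i : driver y i `<=` measurable.
  case: i => //= p _ [C mC <-]; exact: measurable_funPT.
have drI i : setI_closed (driver y i).
  case: i => //= p _ _ [C mC <-] [D mD <-].
  by exists (C `&` D); [exact: measurableI|rewrite !setTI preimage_setI].
have bi := @independent_blocks _ _ _ Pr _ _ _ b mdr drI yi ks.
have mcol j C : measurable C -> <<s \bigcup_(i in [set i | b i = Some j]) driver y i >>
    (column j @^-1` C).
  move=> /(@sigma_joint _ (fun n => y (n, j))).
  apply: sub_smallest2r; first exact: smallest_sigma_algebra.
  by move=> D [n _ Dn]; exists (inr (n, j)).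
have mnone : <<s \bigcup_(i in [set i | b i = None]) driver y i >> (A E None).
  have [s0|s0] := boolP (inl tt \in s).
    rewrite (_ : A E None = E (inl tt)).
      by apply: sub_sigma_algebra; exists (inl tt) => //; exact: (FE (inl tt)).
    apply/seteqP; split => w; first by apply.
    by move=> Ew [[]|p] //= [].
  rewrite (_ : A E None = setT); first exact: (@measurableT _ (g_sigma_algebraType _)).
  by apply/seteqP; split => // w _ [[]|p] [si pb] //; move: s0; rewrite si.
rewrite AE bi; [|exact: undup_uniq|]; last first.
  by move=> [j|] _; [rewrite AS; apply: mcol; rewrite -[X in measurable X]setTI;
    exact: measurable_thin|].
under eq_bigr do rewrite PrA.
rewrite -bi; [|exact: undup_uniq|]; last first.
  by move=> [j|] _; [rewrite A'S; exact: mcol|rewrite -AN].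
rewrite -AE yi//; last first.
  move=> [u|p] si /=; first exact: (FE _ si).
  by exists (B p); [have [] := BP p|rewrite setTI].
apply: eq_big_seq => -[//|p] ps /=.
by have [mB ->//] := BP p; rewrite Pr1.
Qed.

End driven_family.

(** * Sampling from exponential variables *)

Lemma countable_bigcap_measurable d (T : measurableType d) (I : Type)
    (E : I -> set T) : countable [set: I] ->
  (forall i, measurable (E i)) -> measurable (\bigcap_i E i).
Proof.
move=> cI mE; rewrite -[X in measurable X]setCK setC_bigcap; apply: measurableC.
by apply: countable_bigcupT_measurable => // i; exact: measurableC.
Qed.

(** Outside the union of the disjoint sets [J b], the choice defaults to
    [point]. *)
Lemma measurable_xget d (T : measurableType d) (A : pointedType) (J : A -> set T) a :
  countable [set: A] -> (forall b, measurable (J b)) ->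
  (forall b c w, J b w -> J c w -> b = c) ->
  measurable [set w | xget point [set b | J b w] = a].
Proof.
move=> cA mJ J_inj.
have JE b w : J b w -> xget point [set b | J b w] = b.
  by move=> Jb; case: xgetP => [c _ Jc|/(_ b)//]; exact: J_inj Jc Jb.
have mUJ : measurable (\bigcup_b J b) by exact: countable_bigcupT_measurable.
rewrite (_ : [set _ | _] =
    J a `|` (if pselect (a = point) then ~` \bigcup_b J b else set0)).
  by apply: measurableU => //; case: (pselect (a = point)) => //= ap;
    exact: measurableC.
apply/seteqP; split => w /=.
  move=> xa; have [[b _ Jb]|nJ] := pselect ((\bigcup_b J b) w).
    by left; rewrite -xa (JE _ _ Jb).
  right; case: (pselect (a = point)) => //= ap; apply: ap; rewrite -xa.
  by case: xgetP => // b _ Jb; exfalso; apply: nJ; exists b.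
move=> [/JE//|]; case: (pselect (a = point)) => //= -> nJ.
by case: xgetP => // b _ Jb; exfalso; apply: nJ; exists b.
Qed.

Section countable_index.
Context (I : Type) (code : I -> nat) (code_inj : injective code).

(** Transports a family indexed by a countable type to the natural numbers. *)
Definition fiber (U : Type) (E : I -> set U) (n : nat) : set U :=
  \bigcup_(i in [set i | code i = n]) E i.

Lemma fiber_code (U : Type) (E : I -> set U) i : fiber E (code i) = E i.
Proof.
rewrite /fiber (_ : [set _ | _] = [set i]) ?bigcup_set1//.
by apply/seteqP; split => j /=; [exact: code_inj|move=> ->].
Qed.

Lemma fiberP (U : Type) (E : I -> set U) n :
  (exists2 i, code i = n & fiber E n = E i) \/
  ((forall i, code i <> n) /\ fiber E n = set0).
Proof.
have [[i <-]|no] := pselect (exists i, code i = n).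
  by left; exists i => //; rewrite fiber_code.
right; split; first by move=> i ic; apply: no; exists i.
by rewrite -subset0 => w [i /= ic _]; apply: no; exists i.
Qed.

Lemma bigcup_fiber (U : Type) (E : I -> set U) : \bigcup_i E i = \bigcup_n fiber E n.
Proof.
apply/seteqP; split => w; last by move=> [n _ [i _ Ei]]; exists i.
by move=> [i _ Ei]; exists (code i) => //; rewrite fiber_code.
Qed.

Lemma measurable_fiber d (T : measurableType d) (E : I -> set T) :
  (forall i, measurable (E i)) -> forall n, measurable (fiber E n).
Proof. by move=> mE n; have [[i _ ->]|[_ ->]] := fiberP E n. Qed.

Lemma measure_countable_bigcup d (T : measurableType d) (R : realType)
    (m : {measure set T -> \bar R}) (E : I -> set T) :
  (forall i, measurable (E i)) -> (forall i j w, E i w -> E j w -> i = j) ->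
  m (\bigcup_i E i) = (\sum_(n <oo) m (fiber E n))%E.
Proof.
move=> mE tE; rewrite bigcup_fiber measure_bigcup//.
- by apply: eq_eseriesl => n; rewrite in_setT.
- by move=> n _; exact: measurable_fiber.
- by apply/trivIsetP => n k _ _ /eqP nk; rewrite -subset0 => w [[i ic Ei] [j jc Ej]];
    apply: nk; rewrite -ic -jc (tE _ _ _ Ei Ej).
Qed.

Lemma eq_measure_bigcup d1 (T1 : measurableType d1) d2 (T2 : measurableType d2)
    (R : realType) (m1 : {measure set T1 -> \bar R}) (m2 : {measure set T2 -> \bar R})
    (E1 : I -> set T1) (E2 : I -> set T2) :
  (forall i, measurable (E1 i)) -> (forall i, measurable (E2 i)) ->
  (forall i j w, E1 i w -> E1 j w -> i = j) ->
  (forall i j w, E2 i w -> E2 j w -> i = j) ->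
  (forall i, m1 (E1 i) = m2 (E2 i)) ->
  m1 (\bigcup_i E1 i) = m2 (\bigcup_i E2 i).
Proof.
move=> mE1 mE2 tE1 tE2 E12; rewrite !measure_countable_bigcup//.
apply: eq_eseriesr => n _; have [[i <- _]|[no E1n]] := fiberP E1 n.
  by rewrite !fiber_code.
have [[i ic _]|[_ E2n]] := fiberP E2 n; first by have := no i.
by rewrite E1n E2n !measure0.
Qed.

End countable_index.

Section sampler.
Context (R : realType) (A : pointedType) (code : A -> nat).
Hypothesis code_inj : injective code.
Variable p : A -> R.
Hypotheses (p0 : forall a, 0 <= p a)
  (p1 : (\esum_(a in [set: A]) (p a)%:E = 1)%E).

(** The variable [1 - tail x] is uniform on the unit interval when [x] is
    exponential. *)
Lemma expo_cdf (z : R) : 0 <= z -> z <= 1 ->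
  expo R [set x | 1 - tail x <= z] = z%:E.
Proof.
move=> z0; rewrite le_eqVlt => /orP[/eqP ->|z1].
  rewrite (_ : [set _ | _] = setT) ?probability_setT//.
  by apply/seteqP; split => // x _ /=; rewrite gerBl tail_ge0.
have z1' : 0 < 1 - z by rewrite subr_gt0.
have r0 : 0 <= - ln (1 - z) by rewrite oppr_ge0 ln_le0// gerBl.
rewrite (_ : [set _ | _] = ~` `]- ln (1 - z), +oo[%classic).
  rewrite probability_setC// expo_ray tail_pos// opprK lnK ?posrE//.
  by rewrite -EFinB subKr.
rewrite setCitvr; apply/seteqP; split => x; rewrite /= in_itv/=;
  rewrite lerBlDr -lerBlDl /tail => h.
  have : Num.max 0 x <= - ln (1 - z).
    by rewrite lerNr -ler_expR lnK ?posrE.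
  by rewrite ge_max => /andP[].
have : Num.max 0 x <= - ln (1 - z) by rewrite ge_max r0.
by rewrite lerNr -ler_expR lnK ?posrE.
Qed.

Let S (n : nat) : \bar R := \esum_(a in [set a | (code a < n)%N]) (p a)%:E.

Let S_ge0 n : (0 <= S n)%E.
Proof. by apply: esum_ge0 => a _; rewrite lee_fin. Qed.

Let S_mono n k : (n <= k)%N -> (S n <= S k)%E.
Proof.
move=> nk; rewrite /S !(esum_mkcond [set a | (code a < _)%N]).
apply: le_esum => a _; case: ifPn; rewrite ?inE/= => an.
  by rewrite ifT// inE/= (leq_trans an).
by case: ifP => // _; rewrite lee_fin.
Qed.

Let S_le1 n : (S n <= 1)%E.
Proof.
rewrite -p1 /S (esum_mkcond [set a | (code a < _)%N]); apply: le_esum => a _.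
by case: ifPn => // _; rewrite lee_fin.
Qed.

Let s n : R := fine (S n).

Let sE n : (s n)%:E = S n.
Proof.
rewrite fineK// ge0_fin_numE//.
by rewrite (le_lt_trans (S_le1 n))// ltry.
Qed.

Let s_succ a : s (code a).+1 = s (code a) + p a.
Proof.
apply: EFin_inj; rewrite EFinD !sE /S.
rewrite (esumID [set a]); last by move=> b _; rewrite lee_fin.
rewrite addeC; congr (_ + _)%E.
  congr esum; apply/seteqP; split => b /=.
    move=> [ba bNa]; rewrite ltn_neqAle -ltnS ba andbT.
    by apply/eqP => /code_inj.
  by move=> ba; split; [exact: ltnW|move=> bE; move: ba; rewrite bE ltnn].
rewrite (_ : _ `&` _ = [set a]) ?esum_set1// ?lee_fin//.
by apply/seteqP; split => b /=; [case|move=> ->].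
Qed.

Let J (a : A) : set R := [set x | s (code a) < 1 - tail x <= s (code a).+1].

Let s01 n : 0 <= s n <= 1.
Proof. by rewrite -!lee_fin sE S_ge0 S_le1. Qed.

Let mcdf z : measurable [set x : R | 1 - tail x <= z].
Proof.
rewrite (_ : [set _ | _] = (fun x => 1 - tail x) @^-1` `]-oo, z]%classic).
  rewrite -[X in measurable X]setTI; apply: measurable_funB => //.
  exact: measurable_tail.
by apply/seteqP; split => x; rewrite /= in_itv.
Qed.

Let JE a : J a = [set x | 1 - tail x <= s (code a).+1] `\`
  [set x | 1 - tail x <= s (code a)].
Proof.
apply/seteqP; split => x /=; first by move=> /andP[? ?]; split => //; apply/negP; rewrite -ltNge.
by move=> [h1 /negP h2]; apply/andP; split; rewrite ?ltNge.
Qed.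

Let mJ a : measurable (J a).
Proof. by rewrite JE; exact: measurableD. Qed.

Let expo_J a : expo R (J a) = (p a)%:E.
Proof.
have /andP[s0 s1] := s01 (code a); have /andP[s0' s1'] := s01 (code a).+1.
rewrite JE measureD; [|exact: mcdf|exact: mcdf|]; last first.
  by rewrite /= ltey_eq fin_num_measure//; exact: mcdf.
rewrite setIidr; last first.
  by move=> x /= /le_trans; apply; rewrite s_succ lerDl.
by rewrite /= !expo_cdf// -EFinB s_succ addrAC subrr add0r.
Qed.

Let J_inj a b x : J a x -> J b x -> a = b.
Proof.
have lt_J c e : J c x -> J e x -> (code c < code e)%N -> False.
  move=> /andP[_ c1] /andP[e0 _] ce.
  have : s (code c).+1 <= s (code e) by rewrite -lee_fin !sE; exact: S_mono.
  by move=> /(le_trans c1) /(lt_le_trans e0); rewrite ltxx.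
move=> Ja Jb; have [ab|ba|/code_inj//] := ltngtP (code a) (code b).
  by case: (lt_J _ _ Ja Jb ab).
by case: (lt_J _ _ Jb Ja ba).
Qed.

Let countA : countable [set: A].
Proof. by apply/countable_injP; exists code => a b _ _; exact: code_inj. Qed.

Let mUJ : measurable (\bigcup_a J a).
Proof. exact: countable_bigcupT_measurable. Qed.

Let expo_UJ : expo R (\bigcup_a J a) = 1%E.
Proof.
apply/eqP; rewrite eq_le probability_le1//= -p1; apply: ge_ereal_sup => _ [F [finF _] <-].
rewrite (eq_fsbigr (fun a => expo R (J a))); last by move=> a _; rewrite expo_J.
rewrite -measure_fin_bigcup//; first last.
- by move=> a _; exact: mJ.
- by apply/trivIsetP => a b _ _ /eqP ab; rewrite -subset0 => x [Ja Jb];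
    apply: ab; exact: J_inj Jb.
apply: le_measure; rewrite ?inE//; last by move=> x [a _ Ja]; exists a.
by apply: fin_bigcup_measurable => // a _; exact: mJ.
Qed.

(** The unit interval is cut into half-open intervals of lengths [p a], in the
    order given by [code]; they cover it up to a null set. *)
Lemma exists_sampler : exists F : R -> A, forall a,
  measurable [set x | F x = a] /\ expo R [set x | F x = a] = (p a)%:E.
Proof.
pose F (x : R) := xget point [set a | J a x].
have FJ a x : J a x -> F x = a.
  move=> Ja; rewrite /F; case: xgetP => [b _ Jb|/(_ a)//].
  exact: J_inj Jb Ja.
exists F => a.
have mF : measurable [set x | F x = a].
  by apply: (measurable_xget (J := J)) => // b c x; exact: J_inj.
split => //; rewrite -expo_J; apply: ae_eq_measure => //; first exact: mJ.
apply: (@negligibleS _ _ _ (expo R) (~` \bigcup_a J a)).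
  move=> x /= nFJ [b _ Jb]; apply: nFJ; split; last exact: FJ.
  by rewrite (FJ _ _ Jb) => <-.
apply/negligibleP; first exact: measurableC.
by rewrite /= probability_setC// expo_UJ subee.
Qed.

End sampler.

Section driving_variables.
Context (R : realType) (L : lattice) (A : pointedType).
Context d (T : measurableType d) (Pr : probability T R).
Variable X : T -> path_space R L A.

Definition sigma_initial : set (set T) :=
  sigma_RV (fun w => X w (NngNum (lexx 0)) : config L A).

Variables (P : transition_matrix R L A) (Phi : forall j : L, (nbhd j -> A) -> R -> A).
Hypothesis PhiP : forall j (sigma : nbhd j -> A) a,
  measurable [set x | Phi sigma x = a] /\
  expo R [set x | Phi sigma x = a] = (P j sigma a)%:E.
Variable y : nat * L -> {RV Pr >-> R}.
Hypothesis y_exp : exp_driver sigma_initial y.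

(** One family provides both the clocks and the samples: independence of the
    driving randomness then only requires that distinct indices be used. *)
Definition even_times : waiting_times L Pr := fun n j => y (n.*2, j).

Definition odd_samples : samples L A T :=
  fun n j w sigma => Phi sigma (y (n.*2.+1, j) w).

Lemma exp1_even_times : exp1 even_times.
Proof. by move=> n j B mB; have [y1 _] := y_exp; rewrite -expoE -(y1 (n.*2, j) B mB). Qed.

Lemma odd_samples_from : samples_from Pr P odd_samples.
Proof.
move=> n j sigma a; have [mPhi <-] := PhiP sigma a.
have [y1 _] := y_exp.
split; last by rewrite -(y1 (n.*2.+1, j) _ mPhi).
rewrite (_ : [set _ | _] = y (n.*2.+1, j) @^-1` [set x | Phi sigma x = a])//.
exact: measurable_funPTI.
Qed.

Lemma independent_driving : independent Pr (driving even_times odd_samples X).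
Proof.
have [_ yi] := y_exp.
pose phi (i : unit + nat * L + nat * L) : unit + nat * L :=
  match i with
  | inl (inl u) => inl u
  | inl (inr (n, j)) => inr (n.*2, j)
  | inr (n, j) => inr (n.*2.+1, j)
  end.
apply: (independent_sub (phi := phi) _ _ yi).
  move=> [[[]|[n j]]|[n j]] [[[]|[k i]]|[k i]] //= [].
  - by move=> /double_inj -> ->.
  - by move=> /(congr1 odd); rewrite /= !odd_double.
  - by move=> /(congr1 odd); rewrite /= !odd_double.
  - by move=> /double_inj -> ->.
move=> [[[]|[n j]]|[n j]] //=.
apply: smallest_sub.
  by apply: sigma_algebra_preimage; exact: sigma_algebra_measurable.
move=> _ [sigma [a ->]]; exists [set x | Phi sigma x = a].
  by have [] := PhiP sigma a.
by rewrite setTI.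
Qed.

End driving_variables.

(** * Almost sure properties of the clocks *)

Lemma ae_forall_countable d (T : measurableType d) (R : realType)
    (m : {measure set T -> \bar R}) (I : countType) (Q : I -> T -> Prop) :
  (forall i, {ae m, forall w, Q i w}) -> {ae m, forall w, forall i, Q i w}.
Proof.
move=> Qi.
have : {ae m, forall w, forall n, if unpickle n is Some i then Q i w else True}.
  apply/ae_foralln => n; case: (unpickle n) => [i|]; first exact: Qi.
  exact: nearW.
by apply: filterS => w H i; have := H (pickle i); rewrite pickleK.
Qed.

(** Allows to pick a single sample point at which almost sure properties and
    an event of positive probability hold together. *)
Lemma ae_witness d (T : measurableType d) (R : realType) (Pr : probability T R)
    (Q : T -> Prop) (E : set T) : {ae Pr, forall w, Q w} -> measurable E ->
  (0 < Pr E)%E -> exists2 w, E w & Q w.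
Proof.
move=> [N [mN N0 QN]] mE E0; apply: contrapT => no.
have EN : E `<=` N by move=> w Ew; apply: QN => /= Qw; apply: no; exists w.
have : (Pr E <= Pr N)%E by apply: le_measure; rewrite ?inE.
by rewrite N0 leNgt E0.
Qed.

Section iid_sequences.
Context d (T : measurableType d) (R : realType) (Pr : probability T R).
Variable y : nat -> {RV Pr >-> R}.
Hypothesis y_iid : iid_exp y.

(** The probability that all terms lie in [Z] is unchanged when multiplied by
    the probability of [Z]. *)
Lemma iid_never (Z : set R) : measurable Z -> (expo R Z < 1)%E ->
  {ae Pr, forall w, exists n, ~ Z (y n w)}.
Proof.
move=> mZ Z1; pose m := distribution Pr (joint y).
pose F := [set f : fun_space R nat | forall n, Z (f n)].
have mF : measurable F.
  rewrite (_ : F = \bigcap_n [set f : fun_space R nat | Z (f n)]).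
    apply: bigcapT_measurable => n.
    by rewrite -[X in measurable X]setTI; exact: (measurable_coord n).
  by apply/seteqP; split => f; [move=> Ff n _; exact: Ff|move=> Ff n; exact: Ff].
have mFE : m F = (expo R Z * m F)%E.
  rewrite -(iid_rect (joint_iid y_iid))//; congr (m _); apply/seteqP; split => f.
    by move=> Ff; split => [|n]; exact: Ff.
  by move=> [f0 Ff] [|n]; [exact: f0|exact: (Ff n)].
have [x xE] : exists x, expo R Z = x%:E.
  by exists (fine (expo R Z)); rewrite fineK// fin_num_measure.
have [r rE] : exists r, m F = r%:E.
  by exists (fine (m F)); rewrite fineK// fin_num_measure.
move: mFE Z1; rewrite rE xE lte_fin -EFinM => -[] /eqP.
rewrite -subr_eq0 -{1}[r]mul1r -mulrBl mulf_eq0 subr_eq0 eq_sym => rE0 x1.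
have r0 : r = 0 by move: rE0; rewrite (lt_eqF x1)/= => /eqP.
have PrF : Pr (joint y @^-1` F) = 0%E by rewrite -[LHS]/(m F) rE r0.
apply: (@negligibleS _ _ _ Pr (joint y @^-1` F)).
  move=> w /= nw n; apply: contrapT => nZ; apply: nw; by exists n.
by apply/negligibleP => //; exact: measurable_funPTI.
Qed.

End iid_sequences.

Section clocks.
Context (R : realType) (L : lattice).
Context d (T : measurableType d) (Pr : probability T R) (rho : waiting_times L Pr).
Hypotheses (rho_exp1 : exp1 rho)
  (rho_ind : independent Pr (fun p : nat * L => sigma_RV (rho p.1 p.2))).

Lemma iid_clocks : iid_exp (fun p : nat * L => rho p.1 p.2).
Proof. by split => // p B mB; rewrite -(rho_exp1 p.1 p.2 mB). Qed.

Lemma iid_subclocks (phi : nat -> nat * L) : injective phi ->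
  iid_exp (fun n => rho (phi n).1 (phi n).2).
Proof.
move=> phi_inj; split => [n B mB|]; first by rewrite -(rho_exp1 (phi n).1 (phi n).2 mB).
exact: (independent_sub phi_inj (fun n => @subset_refl _ _) rho_ind).
Qed.

Lemma clocks_positive : {ae Pr, forall w, forall p : nat * L, 0 < rho p.1 p.2 w}.
Proof.
apply: ae_forall_countable => p.
apply: (@negligibleS _ _ _ Pr (rho p.1 p.2 @^-1` `]-oo, 0]%classic)).
  by move=> w /= /negP; rewrite in_itv/= -leNgt.
apply/negligibleP; first exact: measurable_funPTI.
by have := rho_exp1 p.1 p.2 (measurable_itv `]-oo, 0]); rewrite -expoE expo_neg.
Qed.

Lemma tau0 j w : tau rho 0 j w = 0.
Proof. by rewrite /tau big_ord0. Qed.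

Lemma tauS n j w : tau rho n.+1 j w = tau rho n j w + rho n j w.
Proof. by rewrite /tau big_ord_recr. Qed.

(** Some waiting time is larger than any prescribed bound. *)
Lemma clocks_unbounded :
  {ae Pr, forall w, forall j t, exists n, t < tau rho n j w}.
Proof.
have H : {ae Pr, forall w, forall jk : L * nat, exists n, jk.2%:R < rho n jk.1 w}.
  apply: ae_forall_countable => -[j k] /=.
  have := iid_never (iid_subclocks (phi := fun n => (n, j)) _)
    (measurable_itv `]-oo, k%:R]).
  rewrite /=.
  have -> : expo R `]-oo, k%:R]%classic = (1 - tail k%:R)%:E.
    by rewrite -(setCitvr (BRight (k%:R : R))) probability_setC// expo_ray.
  rewrite lte_fin ltrBlDr ltrDl expR_gt0 => /(_ _ isT) H.
  have : injective (fun n : nat => (n, j)) by move=> ? ? [].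
  move=> /H; apply: filterS => w [n]; rewrite in_itv/= => /negP.
  by rewrite -ltNge; exists n.
move: H clocks_positive; apply: filterS2 => w H pos j t.
have [n nk] := H (j, Num.bound `|t|).
exists n.+1; rewrite tauS; apply: (@lt_le_trans _ _ (rho n j w)).
  rewrite (le_lt_trans (ler_norm t))// (lt_trans _ nk)//.
  exact: archi_boundP.
rewrite lerDr /tau sumr_ge0// => i _; apply: ltW; exact: (pos (nat_of_ord i, j)).
Qed.

End clocks.

(** * Causality and finite neighbourhoods *)

Lemma expo_interval_gt0 (R : realType) (a b : R) : 0 <= a -> a < b ->
  (0 < expo R `]a, b[%classic)%E.
Proof.
move=> a0 ab; have [c /andP[ac cb]] : exists c, a < c < b.
  by exists ((a + b) / 2); rewrite !midf_lt.
apply: (@lt_le_trans _ _ (expo R (`]a, +oo[%classic `\` `]c, +oo[%classic))).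
  rewrite measureD//=; last by rewrite ltey_eq fin_num_measure.
  rewrite setIidr; last by apply: subset_itvr; rewrite bnd_simp ltW.
  rewrite !expo_ray lte_fin subr_gt0 !tail_pos// ?ltr_expR ?ltrN2//.
  by rewrite (le_trans a0)// ltW.
apply: le_measure; rewrite ?inE//; first exact: measurableD.
move=> x /=; rewrite !in_itv/= !andbT => -[-> /negP]; rewrite -leNgt => xc.
by rewrite (le_lt_trans xc).
Qed.

Section finite_neighbourhoods.
Context (R : realType) (L : lattice).
Context d (T : measurableType d) (Pr : probability T R) (rho : waiting_times L Pr).
Hypotheses (rho_exp1 : exp1 rho)
  (rho_ind : independent Pr (fun p : nat * L => sigma_RV (rho p.1 p.2))).

Let backtrack_stuck (w : T) (j : L) (f : nat -> L) :
  (forall n, nbhd j (f n)) -> (forall n i, 0 < rho n i w) ->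
  rho 0 j w < 1 ->
  (forall a b : R, 0 <= a -> a < b ->
     exists n, a < rho 0 (f n) w < b) ->
  forall n s K, backtrack (update rho w) 1 j n s K ->
  0 < s /\ (s = 1 /\ K = [set j] \/ nbhd j `<=` K).
Proof.
move=> fj pos rj dense n s K; elim => [|{}n {}s {}K s' _ [s0 IH] _]; first by split => //; left.
have upd1 i : update rho w (rho 0 i w, i).
  by exists 1%N, i; rewrite tauS tau0 add0r.
move=> [[/= /andP[s'0 s's] [i [Ki Ui]]] max].
case: IH => [[s1 KE]|jK]; last first.
  exfalso; have [n' /andP[s'n ns]] := dense s' s s'0 s's.
  have : rho 0 (f n') w <= s'.
    apply: max; split; first by rewrite ltW//= (le_lt_trans s'0).
    by exists (f n'); split; [exact/jK/fj|exact: upd1].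
  by rewrite leNgt s'n.
split.
  apply: (lt_le_trans (pos 0%N j)); apply: max; split.
    by rewrite (ltW (pos _ _))/= s1.
  by exists j; rewrite KE; split => //; exact: upd1.
right; move=> k jk; right; exists j => //=; rewrite KE; split => //.
by move: Ki Ui; rewrite KE => ->.
Qed.

(** An infinite neighbourhood would carry a dense set of update times, and the
    backtracking recursion, once it reaches such a neighbourhood, would not
    find a last update. *)
Lemma causal_finite_nbhd : causal_exp1 R L -> forall j : L, finite_set (nbhd j).
Proof.
move=> causalL j; apply: contrapT => infj.
have /infiniteP/card_leP[f0] := infj.
pose toT (n : nat) : [set: nat] := exist _ n (mem_set I).
pose f n : L := val (f0 (toT n)).
have fj n : nbhd j (f n) by exact: set_valP.
have f_inj : injective f.
  by move=> a b /val_inj /(@inj _ _ _ f0); rewrite !inE => /(_ I I) /(congr1 val).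
(* Already the first clocks of infinitely many sites are dense. *)
have dense : {ae Pr, forall w, forall ab : rat * rat,
    0 <= ratr ab.1 :> R -> ratr ab.1 < ratr ab.2 :> R ->
    exists n, ratr ab.1 < rho 0 (f n) w < ratr ab.2}.
  apply: ae_forall_countable => -[a b] /=.
  have [a0|_] := leP (0 : R) (ratr a); last first.
    by apply: nearW.
  have [ab|_] := ltP (ratr a : R) (ratr b); last first.
    by apply: nearW.
  have phi_inj : injective (fun n => (0%N, f n)) by move=> n k [] /f_inj.
  have := iid_never (iid_subclocks rho_exp1 rho_ind phi_inj)
    (measurableC (measurable_itv `]ratr a, ratr b[)).
  rewrite probability_setC// => H.
  have /H : (1 - expo R `](ratr a), (ratr b)[%classic < 1)%E.
    have := expo_interval_gt0 a0 ab.
    rewrite -(fineK (fin_num_measure (expo R) _ (measurable_itv `](ratr a), (ratr b)[))).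
    by rewrite -EFinB !lte_fin ltrBlDr ltrDl.
  apply: filterS => w [n nab] _ _; exists n.
  by move: nab => /contrapT; rewrite /= in_itv.
pose E := rho 0%N j @^-1` `]0, 1[%classic.
have E0 : (0 < Pr E)%E.
  have := rho_exp1 0%N j (measurable_itv `]0, 1[).
  rewrite /distribution /pushforward /= => ->.
  by rewrite -expoE; exact: expo_interval_gt0.
have mE : measurable E by exact: measurable_funPTI.
have pos := clocks_positive rho_exp1.
have bt := @causalL _ _ _ _ rho_exp1 rho_ind 1 j ler01.
have all : {ae Pr, forall w, [/\ forall p : nat * L, 0 < rho p.1 p.2 w,
    exists n K, backtrack (update rho w) 1 j n 0 K &
    forall ab : rat * rat, 0 <= ratr ab.1 :> R -> ratr ab.1 < ratr ab.2 :> R ->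
    exists n, ratr ab.1 < rho 0 (f n) w < ratr ab.2]}.
  by move: pos bt dense; apply: filterS3 => w; split.
have [w Ew [posw [n [K bw]] densew]] := ae_witness all mE E0.
have := @backtrack_stuck w j f fj (fun n i => posw (n, i)) _ _ n 0 K bw.
case=> [||]; last by rewrite ltxx.
  by move: Ew; rewrite /E /= in_itv/= => /andP[].
move=> a b a0 ab.
have [a' ] := rat_in_itvoo ab; rewrite in_itv/= => /andP[aa' a'b].
have [b' ] := rat_in_itvoo a'b; rewrite in_itv/= => /andP[a'b' b'b].
have [k /andP[ak kb]] := densew (a', b') (ltW (le_lt_trans a0 aa')) a'b'.
by exists k; rewrite (lt_trans aa')//= (lt_trans kb).
Qed.

End finite_neighbourhoods.

(** * Dependency trees *)

Section dependency.
Context (R : realType) (L : lattice).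
Context d (T : measurableType d) (Pr : probability T R) (rho : waiting_times L Pr).

(** Here and below the index is [0] if the update times are bounded by the
    given time, which almost surely does not happen. *)
Definition last_before (w : T) (s : R) (i : L) : nat :=
  first_index (fun m => s <= tau rho m.+1 i w).

Definition last_upto (w : T) (t : R) (i : L) : nat :=
  first_index (fun m => t < tau rho m.+1 i w).

(** The value produced by the [n]-th update of [j] depends on the values
    produced by the last updates of its neighbours before that time;
    [depth_le w f n j] bounds the depth of the resulting tree. *)
Fixpoint depth_le (w : T) (f n : nat) (j : L) : Prop :=
  if n is n'.+1 then
    if f is f'.+1 then
      forall i, nbhd j i -> depth_le w f' (last_before w (tau rho n j w) i) i
    else False
  else True.

Definition regular (w : T) := [/\ forall p : nat * L, 0 < rho p.1 p.2 w,
  forall j t, exists n, t < tau rho n j w &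
  forall n j, exists f, depth_le w f n j].

Section positive.
Variable w : T.
Hypothesis pos : forall p : nat * L, 0 < rho p.1 p.2 w.

Lemma tau_ltS n j : tau rho n j w < tau rho n.+1 j w.
Proof. by rewrite tauS ltrDl; exact: (pos (n, j)). Qed.

Lemma tau_lt j : {homo (fun n => tau rho n j w) : n m / (n < m)%N >-> n < m}.
Proof. by apply: homo_ltn => [x y z|n]; [exact: lt_trans|exact: tau_ltS]. Qed.

Lemma tau_le j : {homo (fun n => tau rho n j w) : n m / (n <= m)%N >-> n <= m}.
Proof. by apply: homo_leq => [x|x y z|n] //; [exact: le_trans|exact/ltW/tau_ltS]. Qed.

Lemma tau_ge0 n j : 0 <= tau rho n j w.
Proof. by rewrite -(tau0 rho j w); exact: tau_le. Qed.

Lemma last_before_lt s i : 0 < s -> tau rho (last_before w s i) i w < s.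
Proof.
move=> s0; case mE : (last_before w s i) => [|m]; first by rewrite tau0.
have := @first_index_before (fun m => s <= tau rho m.+1 i w) m.
by rewrite -/(last_before w s i) mE ltnSn -ltNge; apply.
Qed.

Lemma last_before_ge s i : (exists n, s < tau rho n i w) ->
  s <= tau rho (last_before w s i).+1 i w.
Proof.
move=> [n sn]; apply: (@first_index_hit (fun m => s <= tau rho m.+1 i w)).
by exists n; rewrite (le_trans (ltW sn))// ltW// tau_ltS.
Qed.

Lemma last_upto_le t i : 0 <= t -> tau rho (last_upto w t i) i w <= t.
Proof.
move=> t0; case mE : (last_upto w t i) => [|m]; first by rewrite tau0.
have := @first_index_before (fun m => t < tau rho m.+1 i w) m.
by rewrite -/(last_upto w t i) mE ltnSn -leNgt; apply.
Qed.

Lemma last_upto_unique t i m : tau rho m i w <= t -> t < tau rho m.+1 i w ->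
  last_upto w t i = m.
Proof.
move=> mt tm; apply: first_indexE => // k km.
by rewrite -leNgt (le_trans (tau_le i km)).
Qed.

Lemma last_upto_gt t i : (exists n, t < tau rho n i w) ->
  t < tau rho (last_upto w t i).+1 i w.
Proof.
move=> [n tn]; apply: (@first_index_hit (fun m => t < tau rho m.+1 i w)).
by exists n; rewrite (lt_trans tn)// tau_ltS.
Qed.

Lemma depth_leS f n j : depth_le w f n j -> depth_le w f.+1 n j.
Proof.
by elim: f n j => [|f IH] [|n] j //= H i ji; apply: IH; exact: H.
Qed.

(** Read backwards, the recursion shows that every update of a site of [K]
    before time [s] only depends on updates at the later times of the
    recursion, which strictly decrease to zero. *)
Lemma backtrack_depth t j n K : backtrack (update rho w) t j n 0 K ->
  exists f, forall p, tau rho p j w < t -> depth_le w f p j.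
Proof.
pose Q (s : R) (K : set L) :=
  exists f, forall i p, K i -> tau rho p i w < s -> depth_le w f p i.
have main n' s K' : backtrack (update rho w) t j n' s K' -> Q s K' -> Q t [set j].
  elim => // {}n' {}s {}K' s' _ IH s0 [[/= /andP[s'0 s's] _] max] [f Qf].
  apply: IH; exists f.+1 => i [//|p] Ki ps.
  have ps' : tau rho p.+1 i w <= s'.
    apply: max; split; first by rewrite tau_ge0.
    by exists i; split => //; exists p.+1, i.
  move: ps'; rewrite le_eqVlt => /orP[/eqP ps'|ps']; last first.
    by apply: depth_leS; apply: Qf => //; left.
  move=> k ik; apply: Qf.
    by right; exists i => //; split => //; exists p.+1, i; rewrite ps'.
  rewrite -ps'; apply: last_before_lt.
  by rewrite (le_lt_trans (tau_ge0 p i))// tau_ltS.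
move=> /main; case.
  exists 0%N => i p _; rewrite ltNge => /negP[]; exact: tau_ge0.
by move=> f Qf; exists f => p; exact: Qf.
Qed.

End positive.

Lemma regular_ae : causal_exp1 R L -> exp1 rho ->
  independent Pr (fun p : nat * L => sigma_RV (rho p.1 p.2)) ->
  {ae Pr, forall w, regular w}.
Proof.
move=> causalL rho1 rhoi.
have bt : {ae Pr, forall w, forall tj : nat * L,
    exists n K, backtrack (update rho w) tj.1%:R tj.2 n 0 K}.
  apply: ae_forall_countable => tj.
  by apply: (@causalL _ _ _ _ rho1 rhoi); exact: ler0n.
move: (clocks_positive rho1) (clocks_unbounded rho1 rhoi) bt.
apply: filterS3 => w pos unb bw; split => // n j.
have [m [K bmK]] := bw (Num.bound (tau rho n j w), j).
have [f Hf] := backtrack_depth pos bmK.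
by exists f; apply: Hf; apply: archi_boundP; exact: tau_ge0.
Qed.

End dependency.

(** * Existence of trajectories *)

(** A local configuration is coded by its table on the finite list [s]. *)
Lemma countable_local_configurations (L : lattice) (A : pointedType) (j : L) :
  countable [set: A] -> finite_set (nbhd j) -> countable [set: nbhd j -> A].
Proof.
move=> /countable_injP[code code_inj] /finite_seqP[s sE].
pose table (sigma : nbhd j -> A) (i : L) : nat :=
  if insub i is Some u then code (sigma u) else 0.
apply/countable_injP; exists (fun sigma => pickle (map (table sigma) s)).
move=> sigma sigma' _ _ /(pcan_inj pickleK) /eq_in_map tE.
apply/funext => u.
have us : val u \in s.
  by have : [set` s] (val u) by rewrite -sE; exact: set_valP.
by have := tE _ us; rewrite /table valK => /code_inj; rewrite !inE; apply.
Qed.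

Section graphical_construction.
Context (R : realType) (L : lattice) (A : pointedType).
Context d (T : measurableType d) (Pr : probability T R) (rho : waiting_times L Pr).
Variables (S : samples L A T) (X0 : T -> config L A).
Hypotheses (cA : countable [set: A]) (finN : forall j : L, finite_set (nbhd j)).
Hypothesis mX0 : forall j a, measurable [set w | X0 w j = a].
Hypothesis mS : forall n j (sigma : nbhd j -> A) a,
  measurable [set w | S n w sigma = a].

(** The natural number [f] is fuel; it suffices as soon as it bounds the depth
    of the dependency tree. *)
Fixpoint value (w : T) (f n : nat) (j : L) : A :=
  match n, f with
  | 0, _ => X0 w j
  | n'.+1, 0 => point
  | n'.+1, f'.+1 => S n' w (fun i : nbhd j =>
      value w f' (last_before rho w (tau rho n j w) (val i)) (val i))
  end.

Definition final_value (w : T) (n : nat) (j : L) : A :=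
  xget point [set a | exists f0, forall f, (f0 <= f)%N -> value w f n j = a].

(** The case distinction makes the initial configuration equal to [X0]
    everywhere and not only almost surely. *)
Definition graphical (w : T) : path_space R L A := fun t j =>
  if t%:num == 0 then X0 w j else final_value w (last_upto rho w t%:num j) j.

Lemma value_depth w f g n j : depth_le rho w f n j -> (f <= g)%N ->
  value w g n j = value w f n j.
Proof.
elim: f g n j => [|f IH] [|g] [|n] j //= H fg; congr (S n w).
by apply/funext => i; apply: IH => //; apply: H; exact: set_valP.
Qed.

Lemma final_value_depth w f n j : depth_le rho w f n j ->
  final_value w n j = value w f n j.
Proof.
move=> H; rewrite /final_value; case: xgetP => [a _ [f0 Ha]|/(_ (value w f n j))[]].
  rewrite -(value_depth H (leq_maxl f f0)) Ha//; exact: leq_maxr.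
by exists f => g; exact: value_depth.
Qed.

Lemma final_value0 w j : final_value w 0 j = X0 w j.
Proof. exact: (@final_value_depth w 0 0 j). Qed.

Lemma final_valueS w n j : regular rho w ->
  final_value w n.+1 j = S n w (fun i : nbhd j =>
    final_value w (last_before rho w (tau rho n.+1 j w) (val i)) (val i)).
Proof.
move=> [_ _ /(_ n.+1 j)[[//|f] H]].
rewrite (final_value_depth H) /=; congr (S n w); apply/funext => i.
by rewrite -final_value_depth//; apply: H; exact: set_valP.
Qed.

Lemma measurable_tau n j : measurable_fun setT (tau rho n j).
Proof. by apply: measurable_sum => i; exact: measurable_funPT. Qed.

Let mle (f g : T -> R) : measurable_fun setT f -> measurable_fun setT g ->
  measurable [set w | f w <= g w].
Proof.
move=> mf mg; rewrite (_ : [set _ | _] = (fun w => g w - f w) @^-1` `[0, +oo[%classic).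
  by rewrite -[X in measurable X]setTI; apply: measurable_funB.
by apply/seteqP; split => w; rewrite /= in_itv/= andbT subr_ge0.
Qed.

Let mlt (f g : T -> R) : measurable_fun setT f -> measurable_fun setT g ->
  measurable [set w | f w < g w].
Proof.
move=> mf mg; rewrite (_ : [set _ | _] = ~` [set w | g w <= f w]).
  by apply: measurableC; exact: mle.
by apply/seteqP; split => w /=; rewrite ltNge => /negP.
Qed.

Lemma measurable_last_before (f : T -> R) i m : measurable_fun setT f ->
  measurable [set w | last_before rho w (f w) i = m].
Proof.
move=> mf; apply: measurable_first_index => k.
by apply: mle => //; exact: measurable_tau.
Qed.

Lemma measurable_last_upto (t : R) i m :
  measurable [set w | last_upto rho w t i = m].
Proof.
apply: measurable_first_index => k; apply: mlt; first exact: measurable_cst.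
exact: measurable_tau.
Qed.

Lemma measurable_value f n j a : measurable [set w | value w f n j = a].
Proof.
elim: f n j a => [|f IH] [|n] j a //=.
  by have [<-|pa] := pselect (point = a);
    [rewrite (_ : [set _ | _] = setT)//; apply/seteqP
    |rewrite (_ : [set _ | _] = set0)//; apply/seteqP; split].
pose g w (i : nbhd j) :=
  value w f (last_before rho w (tau rho n.+1 j w) (val i)) (val i).
have mg (i : nbhd j) b : measurable [set w | g w i = b].
  rewrite (_ : [set _ | _] = \bigcup_m
      ([set w | last_before rho w (tau rho n.+1 j w) (val i) = m] `&`
       [set w | value w f m (val i) = b])).
    apply: bigcupT_measurable => m; apply: measurableI => //.
    by apply: measurable_last_before; exact: measurable_tau.
  apply/seteqP; split => w /=; last by move=> [m _ [/= <-]].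
  by move=> gb; exists (last_before rho w (tau rho n.+1 j w) (val i)).
rewrite (_ : [set _ | _] = \bigcup_(sigma : nbhd j -> A)
    ([set w | S n w sigma = a] `&` \bigcap_i [set w | g w i = sigma i])).
  apply: countable_bigcupT_measurable; first exact: countable_local_configurations.
  move=> sigma; apply: measurableI => //.
  apply: countable_bigcap_measurable => //; exact: countableP.
apply/seteqP; split => w /=; first by move=> Sa; exists (g w).
move=> [sigma _ [/= <- gs]]; congr (S n w); apply/funext => i.
exact: (gs i).
Qed.

Lemma measurable_final_value n j a : measurable [set w | final_value w n j = a].
Proof.
apply: (measurable_xget (J := fun b => [set w | exists f0, forall f,
    (f0 <= f)%N -> value w f n j = b])) => // [b|b c w [f Hb] [g Hc]].
  rewrite (_ : [set _ | _] = \bigcup_f0 \bigcap_(f in [set f | (f0 <= f)%N])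
      [set w | value w f n j = b]).
    apply: bigcupT_measurable => f0; apply: bigcap_measurableType => f _.
    exact: measurable_value.
  apply/seteqP; split => w /=; first by move=> [f0 H]; exists f0.
  by move=> [f0 _ H]; exists f0.
by rewrite -(Hb _ (leq_maxl f g)) Hc// leq_maxr.
Qed.

Lemma measurable_graphical : measurable_fun setT graphical.
Proof.
apply: (@measurability _ _ _ _ [set: T] graphical (@path_cylinders R L A)) => //.
move=> _ [_ [t [j [a ->]]] <-]; rewrite setTI.
have [t0|t0] := eqVneq t%:num 0.
  rewrite (_ : _ @^-1` _ = [set w | X0 w j = a])//.
  by apply/seteqP; split => w; rewrite /= /graphical t0 eqxx.
rewrite (_ : _ @^-1` _ = \bigcup_m ([set w | last_upto rho w t%:num j = m] `&`
    [set w | final_value w m j = a])).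
  apply: bigcupT_measurable => m; apply: measurableI.
    exact: measurable_last_upto.
  exact: measurable_final_value.
apply/seteqP; split => w; rewrite /= /graphical (negbTE t0).
  by move=> H; exists (last_upto rho w t%:num j).
by move=> [m _ [/= <-]].
Qed.

Lemma graphicalE w t j : regular rho w ->
  graphical w t j = final_value w (last_upto rho w t%:num j) j.
Proof.
move=> [pos _ _]; rewrite /graphical; case: eqP => // t0.
rewrite (@last_upto_unique _ _ _ _ _ _ w pos _ _ 0%N) ?final_value0//.
  by rewrite tau0 t0.
by rewrite tauS tau0 add0r t0; exact: (pos (0%N, j)).
Qed.

Lemma graphical_constant w : regular rho w ->
  constant_between_clocks rho graphical w.
Proof.
move=> rw n j s t sE /andP[nt tn]; rewrite !graphicalE//; case: (rw) => pos _ _.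
rewrite (last_upto_unique pos nt tn) sE (@last_upto_unique _ _ _ _ _ _ w pos _ _ n)//.
exact: tau_ltS.
Qed.

(** The left limits of the neighbours are the values produced by their last
    updates, by which the recursion computes the new value. *)
Lemma graphical_updated w : regular rho w ->
  updated_at_clocks rho S graphical w.
Proof.
move=> rw n j s sigma sE lim; case: (rw) => pos unb _.
rewrite graphicalE// sE (@last_upto_unique _ _ _ _ _ _ w pos _ _ n.+1)//; last first.
  exact: tau_ltS.
rewrite final_valueS//; congr (S n w); apply/funext => i.
have s0 : 0 < tau rho n.+1 j w.
  by rewrite (le_lt_trans (tau_ge0 pos n j))// tau_ltS.
set m := last_before _ _ _ _.
have ms : tau rho m (val i) w < tau rho n.+1 j w by exact: last_before_lt.
have sm : tau rho n.+1 j w <= tau rho m.+1 (val i) w.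
  by apply: last_before_ge => //; exact: unb.
have [e e0 He] := lim i.
(* A time close enough to the update, after the last update of [i]. *)
pose u := Num.max (tau rho m (val i) w) (tau rho n.+1 j w - e / 2).
have u0 : 0 <= u by rewrite le_max tau_ge0.
have us : u < tau rho n.+1 j w by rewrite gt_max ms/= ltrBlDr ltrDl divr_gt0.
rewrite -(He (NngNum u0)); last first.
  rewrite sE /= us andbT lt_max; apply/orP; right.
  by rewrite ltrD2l ltrN2 ltr_pdivrMr// ltr_pMr// ltr1n.
rewrite graphicalE// (@last_upto_unique _ _ _ _ _ _ w pos _ _ m)//=.
  by rewrite le_max lexx.
exact: lt_le_trans sm.
Qed.

End graphical_construction.

(** * Values at update times and their dependencies *)

Section node_values.
Context (R : realType) (L : lattice) (A : pointedType).
Context d (T : measurableType d) (Pr : probability T R) (rho : waiting_times L Pr).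
Variables (S : samples L A T) (X : T -> path_space R L A).

Definition well_driven (w : T) :=
  [/\ regular rho w, constant_between_clocks rho X w & updated_at_clocks rho S X w].

Definition node_value (w : T) (p : nat * L) : A :=
  X w (NngNum (normr_ge0 (tau rho p.1 p.2 w))) p.2.

Section fixed_sample_point.
Variable w : T.
Hypothesis ww : well_driven w.

Let pos : forall p : nat * L, 0 < rho p.1 p.2 w.
Proof. by case: ww => -[]. Qed.

Let unb : forall j t, exists n, t < tau rho n j w.
Proof. by case: ww => -[]. Qed.

Let node_time n j : (NngNum (normr_ge0 (tau rho n j w)))%:num = tau rho n j w.
Proof. by rewrite /= ger0_norm// tau_ge0. Qed.

Lemma value_between n j t : tau rho n j w <= t%:num < tau rho n.+1 j w ->
  X w t j = node_value w (n, j).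
Proof. by case: ww => _ Xconst _; apply: Xconst; exact: node_time. Qed.

Lemma value_last_upto t j : X w t j = node_value w (last_upto rho w t%:num j, j).
Proof.
by apply: value_between; rewrite last_upto_le//= last_upto_gt.
Qed.

Lemma node_value0 j : node_value w (0%N, j) = X w (NngNum (lexx 0)) j.
Proof.
by rewrite /node_value; congr (X w _ j); apply: val_inj; rewrite /= tau0 normr0.
Qed.

(** At an update time the left limits of the neighbours are their values after
    their own last updates. *)
Lemma node_valueS n j : node_value w (n.+1, j) = S n w (fun i : nbhd j =>
  node_value w (last_before rho w (tau rho n.+1 j w) (val i), val i)).
Proof.
case: ww => _ _ Xupd; apply: Xupd; first exact: node_time.
move=> i; rewrite /left_limit node_time; set s := tau rho n.+1 j w.
have s0 : 0 < s by rewrite (le_lt_trans (tau_ge0 pos n j))// tau_ltS.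
set m := last_before _ _ _ _.
have ms : tau rho m (val i) w < s by exact: last_before_lt.
have sm : s <= tau rho m.+1 (val i) w by apply: last_before_ge => //; exact: unb.
exists (s - tau rho m (val i) w); first by rewrite subr_gt0.
move=> u /andP[]; rewrite subKr => mu us; apply: value_between.
by rewrite ltW//= (lt_le_trans us).
Qed.

End fixed_sample_point.
End node_values.

Section explanations.
Context (L : lattice) (A : pointedType).
Local Notation node := (nat * L)%type.

(** A skeleton lists the nodes on which finitely many target values depend,
    the dependency edges, and the nodes carrying the targets.  It is a finite
    object of a countable type, so that clock configurations can be sorted
    according to it. *)
Definition skeleton := (seq node * seq (node * node) * seq node)%type.

Definition nodes (u : skeleton) : seq node := u.1.1.
Definition edges (u : skeleton) : seq (node * node) := u.1.2.
Definition root_nodes (u : skeleton) : seq node := u.2.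

Definition closed_skeleton (u : skeleton) := [/\ uniq (nodes u),
  {subset root_nodes u <= nodes u} &
  forall n j, (n.+1, j) \in nodes u -> forall i, nbhd j i ->
    exists m, (m, i) \in nodes u /\ ((n.+1, j), (m, i)) \in edges u].

Definition parent (u : skeleton) (p : node) (i : L) : node :=
  head (0%N, i) [seq e.2 | e <- edges u & (e.1 == p) && (e.2.2 == i)].

Definition assigned (u : skeleton) (a : seq A) (p : node) : A :=
  nth point a (index p (nodes u)).

Definition local_config (u : skeleton) (a : seq A) (p : node) : nbhd p.2 -> A :=
  fun i => assigned u a (parent u p (val i)).

Definition compatible d (T : measurableType d) (X0 : T -> L -> A)
    (S : samples L A T) (u : skeleton) (a : seq A) (w : T) (p : node) : Prop :=
  match p with
  | (0, j) => X0 w j = assigned u a p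
  | (n.+1, j) => S n j w (@local_config u a (n.+1, j)) = assigned u a p
  end.

Lemma parentE (u : skeleton) p i m : ((p, (m, i)) : node * node) \in edges u ->
  (forall k, (p, (k, i)) \in edges u -> k = m) -> parent u p i = (m, i).
Proof.
move=> pm unique; rewrite /parent.
case E : [seq _ | _ <- _ & _] => [|q s] /=.
  have : (m, i) \in [seq e.2 | e <- edges u & (e.1 == p) && (e.2.2 == i)].
    by apply/mapP; exists (p, (m, i)) => //; rewrite mem_filter /= !eqxx.
  by rewrite E.
have : q \in [seq e.2 | e <- edges u & (e.1 == p) && (e.2.2 == i)].
  by rewrite E inE eqxx.
move=> /mapP[[p' [k i']]]; rewrite mem_filter /= => /andP[/andP[/eqP -> /eqP ->]].
by move=> /unique -> ->.
Qed.

End explanations.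

Section clock_events.
Context (R : realType) (L : lattice).
Context d (T : measurableType d) (Pr : probability T R) (rho : waiting_times L Pr).

Definition clocks_realise (u : skeleton L) (q : seq ({nonneg R} * L)) (w : T) :=
  (forall n j m i, ((n, j), (m, i)) \in edges u ->
     last_before rho w (tau rho n j w) i = m) /\
  root_nodes u = [seq (last_upto rho w x.1%:num x.2, x.2) | x <- q].

Lemma measurable_clocks_realise u q :
  measurable [set w | clocks_realise u q w].
Proof.
rewrite (_ : [set _ | _] =
  \bigcap_(e in [set` edges u])
    [set w | last_before rho w (tau rho e.1.1 e.1.2 w) e.2.2 = e.2.1] `&`
  [set w | root_nodes u = [seq (last_upto rho w x.1%:num x.2, x.2) | x <- q]]).
  apply: measurableI.
    apply: fin_bigcap_measurable => // e _.
    by apply: measurable_last_before; exact: measurable_tau.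
  elim: q (root_nodes u) => [|x q IH] [|p r] /=.
  - by rewrite (_ : [set _ | _] = setT)//; apply/seteqP.
  - by rewrite (_ : [set _ | _] = set0)//; apply/seteqP; split.
  - by rewrite (_ : [set _ | _] = set0)//; apply/seteqP; split.
  have [px|px] := eqVneq p.2 x.2; last first.
    rewrite (_ : [set _ | _] = set0)//; apply/seteqP; split => w //= -[pE _].
    by move: px; rewrite pE eqxx.
  rewrite (_ : [set _ | _] = [set w | last_upto rho w x.1%:num x.2 = p.1] `&`
    [set w | r = [seq (last_upto rho w x.1%:num x.2, x.2) | x <- q]]).
    by apply: measurableI => //; exact: measurable_last_upto.
  apply/seteqP; split => w /=; first by move=> [-> <-].
  by move=> [E1 E2]; rewrite E1 -E2 -px -surjective_pairing.
apply/seteqP; split => w [H1 H2]; split => //.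
  by move=> [[n j] [m i]]; exact: H1.
by move=> n j m i e; exact: (H1 _ e).
Qed.

Let parents_in (w : T) (F : seq (nat * L)) := forall n j, (n.+1, j) \in F ->
  forall i, nbhd j i -> (last_before rho w (tau rho n.+1 j w) i, i) \in F.

(** The dependency tree has finite depth and finite branching. *)
Let finite_ancestry w f n j : (forall j : L, finite_set (nbhd j)) ->
  depth_le rho w f n j -> exists2 F, (n, j) \in F & parents_in w F.
Proof.
move=> finN; elim: f n j => [|f IH] [|n] j //= H.
- by exists [:: (0%N, j)]; rewrite ?inE// => n k; rewrite inE.
- by exists [:: (0%N, j)]; rewrite ?inE// => k i; rewrite inE.
have /finite_seqP[s sE] := finN j.
have /choice[F FP] (i : L) : exists F, nbhd j i ->
    (last_before rho w (tau rho n.+1 j w) i, i) \in F /\ parents_in w F.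
  have [ji|nji] := pselect (nbhd j i); last by exists [::].
  by have [F ? ?] := IH _ _ (H _ ji); exists F.
exists ((n.+1, j) :: flatten (map F s)); first by rewrite inE eqxx.
move=> n' j'; rewrite inE => /orP[/eqP[-> ->] i ji|].
  rewrite inE; apply/orP; right; apply/flattenP; exists (F i).
    by apply: map_f; have : [set` s] i by rewrite -sE.
  by have [] := FP _ ji.
move=> /flattenP[_ /mapP[i si ->] nF] k jk.
have ji : nbhd j i by rewrite sE.
have [_ /(_ _ _ nF _ jk) kF] := FP _ ji.
rewrite inE; apply/orP; right; apply/flattenP; exists (F i) => //.
exact: map_f.
Qed.

(** Backtracking terminates, so finitely many nodes always suffice. *)
Lemma realised_skeleton q w : (forall j : L, finite_set (nbhd j)) ->
  regular rho w -> exists u, closed_skeleton u /\ clocks_realise u q w.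
Proof.
move=> finN [_ _ deep].
have /choice[nl nlE] (j : L) : exists s : seq L, nbhd j = [set` s].
  exact/finite_seqP.
have /choice[F FP] (p : nat * L) : exists F, p \in F /\ parents_in w F.
  case: p => n j; have [f Hf] := deep n j.
  by have [F ? ?] := finite_ancestry finN Hf; exists F.
pose r := [seq (last_upto rho w x.1%:num x.2, x.2) | x <- q].
pose G := undup (flatten (map F r)).
have GP : parents_in w G.
  move=> n j; rewrite mem_undup => /flattenP[_ /mapP[p pr ->] nF] i ji.
  rewrite mem_undup; apply/flattenP; exists (F p); first exact: map_f.
  by have [_] := FP p; apply.
pose D := [seq (p, (last_before rho w (tau rho p.1 p.2 w) i, i)) | p <- G, i <- nl p.2].
exists (G, D, r); split; split => //=.
- exact: undup_uniq.
- move=> p pr; rewrite mem_undup; apply/flattenP; exists (F p).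
    exact: map_f.
  by have [] := FP p.
- move=> n j nG i ji; exists (last_before rho w (tau rho n.+1 j w) i); split.
    exact: GP.
  apply/allpairsPdep; exists (n.+1, j), i; split => //.
  by have : [set` nl j] i by rewrite -nlE.
- by move=> n j m i /allpairsPdep[p [k [_ _ [<- -> ->]]]].
Qed.

End clock_events.

(** * Explanations of finitely many values *)

Section coordinate_clocks.
Context (R : realType) (L : lattice) (m : probability (fun_space R (nat * L)%type) R).

(** Events about clocks are expressed on the space of clock configurations, so
    that they can be compared between different probability spaces. *)
Definition coordinate_clocks : waiting_times L m := fun n j =>
  HB.pack (fun r : fun_space R (nat * L)%type => r (n, j))
    (isMeasurableFun.Build _ _ _ _ (fun r : fun_space R (nat * L)%type => r (n, j))
      (measurable_coord (n, j))).

End coordinate_clocks.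

Section explanation_events.
Context (R : realType) (L : lattice) (A : pointedType).
Hypothesis finN : forall j : L, finite_set (nbhd j).
Variables (q : seq ({nonneg R} * L)) (c : seq A).
Variable m : probability (fun_space R (nat * L)%type) R.

Let realisable (u : skeleton L) : set (fun_space R (nat * L)%type) :=
  [set r | closed_skeleton u /\ clocks_realise (coordinate_clocks m) u q r].

Let measurable_realisable u : measurable (realisable u).
Proof.
have [cu|ncu] := pselect (closed_skeleton u).
  rewrite (_ : realisable u = [set r | clocks_realise (coordinate_clocks m) u q r]).
    exact: measurable_clocks_realise.
  by apply/seteqP; split => r [].
by rewrite (_ : realisable u = set0)//; apply/seteqP; split => // r [].
Qed.

(** Many skeletons are realised by the same clocks; only the first one in the
    enumeration is retained, which makes the clock events disjoint. *)
Definition first_realised (u : skeleton L) : set (fun_space R (nat * L)%type) :=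
  realisable u `\` \bigcup_(v in [set v | (pickle v < pickle u)%N]) realisable v.

Lemma measurable_first_realised u : measurable (first_realised u).
Proof.
apply: measurableD => //; rewrite bigcup_mkcond.
apply: countable_bigcupT_measurable; first exact: countableP.
by move=> v; case: ifP.
Qed.

Lemma first_realised_inj u v r : first_realised u r -> first_realised v r -> u = v.
Proof.
move=> [ur nu] [vr nv]; apply: (pcan_inj pickleK).
have [uv|vu|//] := ltngtP (pickle u) (pickle v).
  by exfalso; apply: nv; exists u.
by exfalso; apply: nu; exists v.
Qed.

Lemma exists_first_realised u r : realisable u r -> exists v, first_realised v r.
Proof.
move=> ur.
pose b n := `[< exists2 v, pickle v = n & realisable v r >].
have exb : exists n, b n by exists (pickle u); apply/asboolP; exists u.
have /asboolP[v vn vr] := first_index_hit exb.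
exists v; split => // -[v' /= v'v v'r].
have := @first_index_before b (pickle v'); rewrite -vn => /(_ v'v) /asboolPn; apply.
by exists v'.
Qed.

Definition admissible (ua : skeleton L * seq A) := [/\ closed_skeleton ua.1,
  size ua.2 = size (nodes ua.1) &
  [seq assigned ua.1 ua.2 p | p <- root_nodes ua.1] = c].

Section trajectory.
Context d (T : measurableType d) (Pr : probability T R) (rho : waiting_times L Pr).
Variables (S : samples L A T) (X : T -> path_space R L A).

Let Y := joint (fun p : nat * L => rho p.1 p.2).

Definition explanation (ua : skeleton L * seq A) : set T :=
  [set w | [/\ admissible ua, first_realised ua.1 (Y w) &
    forall p, p \in nodes ua.1 ->
      compatible (fun w => X w (NngNum (lexx 0))) S ua.1 ua.2 w p]].

Section sample_point.
Variable w : T.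
Hypothesis ww : well_driven rho S X w.

Let rw : regular rho w. Proof. by case: ww. Qed.

Lemma local_configE u a n j : closed_skeleton u -> clocks_realise rho u q w ->
  (n.+1, j) \in nodes u ->
  @local_config L A u a (n.+1, j) =
  fun i : nbhd j => assigned u a
    (last_before rho w (tau rho n.+1 j w) (val i), val i).
Proof.
move=> [_ _ uc] [ue _] pu; apply/funext => i; rewrite /local_config.
have [m' [mu eu]] := uc _ _ pu (val i) (set_valP i).
rewrite (parentE eu); first by rewrite (ue _ _ _ _ eu).
by move=> k /ue <-; rewrite (ue _ _ _ _ eu).
Qed.

Lemma parent_in_nodes u n j : closed_skeleton u -> clocks_realise rho u q w ->
  (n.+1, j) \in nodes u -> forall i : nbhd j,
  (last_before rho w (tau rho n.+1 j w) (val i), val i) \in nodes u.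
Proof.
move=> [_ _ uc] [ue _] pu i.
have [m' [mu eu]] := uc _ _ pu (val i) (set_valP i).
by rewrite (ue _ _ _ _ eu).
Qed.

(** The compatibility equations determine the assigned values by recursion on
    the depth of the dependency tree. *)
Lemma explanation_value ua p : explanation ua w -> p \in nodes ua.1 ->
  assigned ua.1 ua.2 p = node_value rho X w p.
Proof.
case: ua => u a [[cu _ _] [[_ /= cr] _] comp].
case: p => n j; have [_ _ /(_ n j)[f]] := rw.
elim: f n j => [|f IH] [|n] j //= H pu.
- by have /= <- := comp _ pu; rewrite node_value0.
- by have /= <- := comp _ pu; rewrite node_value0.
have /= <- := comp _ pu; rewrite (node_valueS ww) local_configE//.
congr (S n w _); apply/funext => i; apply: IH; last exact: parent_in_nodes.
by apply: H; exact: set_valP.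
Qed.

Lemma explanation_values ua : explanation ua w ->
  ua.2 = map (node_value rho X w) (nodes ua.1).
Proof.
move=> e; have [[[uu _ _] sz _] _ _] := e.
apply: (@eq_from_nth _ point); first by rewrite size_map.
move=> k; rewrite sz => kn.
have [p0 _] : exists p0, p0 \in nodes ua.1.
  by case: (nodes ua.1) kn => // p0 s _; exists p0; rewrite inE eqxx.
rewrite (nth_map p0)// -(explanation_value e) ?mem_nth//.
by rewrite /assigned index_uniq.
Qed.

Lemma explanation_inj ua ua' : explanation ua w -> explanation ua' w -> ua = ua'.
Proof.
move=> e e'; have [_ r _] := e; have [_ r' _] := e'.
have uu := first_realised_inj r r'.
have := explanation_values e; have := explanation_values e'; rewrite uu.
by case: ua ua' uu {e e' r r'} => u a [u' a'] /= -> -> ->.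
Qed.

(** The explanation consists of a finite dependency structure and of the
    actual values of its updates. *)
Lemma exists_explanation :
  [seq X w x.1 x.2 | x <- q] = c <-> exists ua, explanation ua w.
Proof.
have rootsE u : clocks_realise rho u q w ->
    [seq node_value rho X w p | p <- root_nodes u] = [seq X w x.1 x.2 | x <- q].
  move=> [_ ->]; rewrite -map_comp; apply: eq_map => x /=.
  by rewrite (value_last_upto ww).
split=> [qc|[[u a] e]]; last first.
  have [[[_ ru _] _ ac] [[_ ur] _] _] := e.
  rewrite -(rootsE _ ur) -ac; apply/eq_in_map => p pr.
  by rewrite -(explanation_value e)//; exact: ru.
have [u [cu ur]] := realised_skeleton q finN rw.
have {u cu ur} [u fu] := @exists_first_realised u (Y w) (conj cu ur).
have [[cu ur] _] := fu; have [uu ru pu] := cu.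
pose a := map (node_value rho X w) (nodes u).
have aE p : p \in nodes u -> assigned u a p = node_value rho X w p.
  by move=> pin; rewrite /assigned /a (nth_map p) ?index_mem// nth_index.
exists (u, a); split => //=.
  split => //=; first by rewrite size_map.
  rewrite -qc -(rootsE _ ur); apply/eq_in_map => p pr.
  by rewrite aE//; exact: ru.
move=> [[|n] j] pin /=; first by rewrite aE// node_value0.
rewrite aE// (node_valueS ww) local_configE//; congr (S n w _).
by apply/funext => i; rewrite aE//; exact: parent_in_nodes.
Qed.

End sample_point.

Section law.
Variables (P : transition_matrix R L A) (mu0 : probability (config L A) R).
Hypotheses (SP : samples_from Pr P S)
  (X0mu : forall B : set (config L A), measurable B ->
     Pr [set w | B (X w (NngNum (lexx 0)))] = mu0 B)
  (ind : independent Pr (driving rho S X))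
  (Ym : forall B, measurable B -> Pr (Y @^-1` B) = m B)
  (mX0 : measurable_fun setT (fun w => X w (NngNum (lexx 0)) : config L A)).

Variables (u : skeleton L) (a : seq A).
Hypothesis cu : closed_skeleton u.

Let index := (unit + nat * L + nat * L)%type.

(** The [n.+1]-th update of a site uses its sample of index [n]. *)
Definition node_index (p : nat * L) : index := inr (p.1.-1, p.2).

Definition equation_indices : seq index :=
  inl (inl tt) :: [seq node_index p | p <- nodes u & p.1 != 0%N].

Let initial_set : set (config L A) :=
  [set z | forall j, (0%N, j) \in nodes u -> z j = assigned u a (0%N, j)].

Let equation (i : index) : set T :=
  match i with
  | inl (inl _) => [set w | initial_set (X w (NngNum (lexx 0)))]
  | inr (n, j) => [set w | S n w (@local_config L A u a (n.+1, j)) =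
                           assigned u a (n.+1, j)]
  | _ => setT
  end.

Definition equation_weight (i : index) : \bar R :=
  match i with
  | inl (inl _) => mu0 initial_set
  | inr (n, j) =>
    (P j (@local_config L A u a (n.+1, j)) (assigned u a (n.+1, j)))%:E
  | _ => 1%E
  end.

Let measurable_initial_set : measurable initial_set.
Proof.
rewrite (_ : initial_set = \bigcap_(p in [set p | p \in nodes u /\ p.1 = 0%N])
    [set z | z p.2 = assigned u a p]).
  apply: fin_bigcap_measurable.
    by apply: (@sub_finite_set _ _ [set` nodes u]) => // p [].
  by move=> p _; apply: sub_sigma_algebra; exists p.2, (assigned u a p).
apply/seteqP; split => z H; last by move=> j ju; exact: (H (0%N, j)).
by move=> [n j] [/= ju n0]; move: ju; rewrite n0; exact: H.
Qed.

Let uniq_equation_indices : uniq equation_indices.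
Proof.
have [uu _ _] := cu.
rewrite /equation_indices /=; apply/andP; split; first by apply/mapP => -[].
rewrite map_inj_in_uniq ?filter_uniq// => -[[|n] j] [[|k] i];
  rewrite !mem_filter //= => _ _.
by move=> [-> ->].
Qed.

Let mdriving i : driving rho S X i `<=` measurable.
Proof.
case: i => [[[]|[n j]]|[n j]] /=.
- by move=> _ [B mB <-]; exact: mX0.
- by move=> _ [B mB <-]; rewrite setTI; exact: measurable_funPTI.
- apply: smallest_sub; first exact: sigma_algebra_measurable.
  by move=> _ [sigma [b ->]]; have [] := SP n sigma b.
Qed.

Let driving_setI i : setI_closed (driving rho S X i).
Proof.
case: i => [[[]|[n j]]|[n j]] /=.
- move=> _ _ [B mB <-] [C mC <-]; exists (B `&` C); first exact: measurableI.
  by rewrite !setTI preimage_setI.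
- move=> _ _ [B mB <-] [C mC <-]; exists (B `&` C); first exact: measurableI.
  by rewrite !setTI preimage_setI.
- move=> B C mB mC.
  exact: (@measurableI _ (g_sigma_algebraType
    [set B | exists (sigma : nbhd j -> A) a, B = [set w | S n w sigma = a]])).
Qed.

Let equation_driving i : i \in equation_indices -> driving rho S X i (equation i).
Proof.
rewrite inE => /orP[/eqP ->|/mapP[[n j] _ ->]] /=.
  by exists initial_set => //; rewrite setTI.
by apply: sub_sigma_algebra; eexists; eexists; reflexivity.
Qed.

Let equationsE : [set w | forall p, p \in nodes u ->
    compatible (fun w => X w (NngNum (lexx 0))) S u a w p] =
  \bigcap_(i in [set` equation_indices]) equation i.
Proof.
apply/seteqP; split => w H.
  move=> i /=; rewrite inE => /orP[/eqP -> j ju|]; first exact: (H _ ju).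
  move=> /mapP[[[|n] j]]; rewrite mem_filter //= => pu ->.
  exact: (H _ pu).
move=> [[|n] j] pu /=.
  by apply: (H (inl (inl tt))) => //=; rewrite inE eqxx.
apply: (H (node_index (n.+1, j))) => /=.
by rewrite inE; apply/orP; right; apply/mapP; exists (n.+1, j); rewrite ?mem_filter.
Qed.

(** The local configuration of each update is prescribed by [u] and [a], so the
    event is an intersection of independent events, one for each update, one
    for the clocks and one for the initial configuration. *)
Lemma explanation_weight :
  Pr ([set w | first_realised u (Y w)] `&` [set w | forall p, p \in nodes u ->
    compatible (fun w => X w (NngNum (lexx 0))) S u a w p]) =
  (m (first_realised u) * \prod_(i <- equation_indices) equation_weight i)%E.
Proof.
pose b (i : index) := if i is inl (inr _) then true else false.
have mf := measurable_first_realised u.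
rewrite equationsE.
have := independent_blocks (b := b) mdriving driving_setI ind.
pose E (k : bool) := if k then [set w | first_realised u (Y w)]
  else \bigcap_(i in [set` equation_indices]) equation i.
move=> bind; have memE k : k \in [:: true; false] ->
    <<s \bigcup_(i in [set i | b i = k]) driving rho S X i >> (E k).
  case: k => _ /=.
    have := sigma_joint (y := fun p : nat * L => rho p.1 p.2) mf.
    apply: sub_smallest2r; first exact: smallest_sigma_algebra.
    by move=> B [[n j] _ Bnj]; exists (inl (inr (n, j))).
  apply: (@fin_bigcap_measurable _ (g_sigma_algebraType _)) => // i ii.
  apply: sub_sigma_algebra; exists i; last exact: equation_driving.
  by move: ii; rewrite /= inE => /orP[/eqP ->|/mapP[p _ ->]].
have bindE : Pr (E true `&` E false) = (Pr (E true) * Pr (E false))%E.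
  have := bind [:: true; false] E isT memE.
  rewrite (bigcap_cons true) (bigcap_cons false) set_nil bigcap_set0 setIT.
  by rewrite !big_cons big_nil mule1.
rewrite [LHS]bindE /E -(Ym mf) ind//; congr (_ * _)%E; apply: eq_big_seq => i.
rewrite inE => /orP[/eqP ->|/mapP[[n j] _ ->]] /=.
  by rewrite X0mu.
by have [_ ->] := SP n.-1 (@local_config L A u a (n.-1.+1, j))
  (assigned u a (n.-1.+1, j)).
Qed.

Lemma measurable_explanation_equations :
  measurable ([set w | first_realised u (Y w)] `&` [set w | forall p, p \in nodes u ->
    compatible (fun w => X w (NngNum (lexx 0))) S u a w p]).
Proof.
apply: measurableI.
  rewrite -[X in measurable X]setTI; apply: measurable_fun_joint => //.
  exact: measurable_first_realised.
rewrite equationsE; apply: fin_bigcap_measurable => // i ii.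
by apply: mdriving; exact: equation_driving.
Qed.

End law.
End trajectory.
End explanation_events.

(** * Uniqueness in law *)

Definition targets (R : realType) (L : lattice) (A : pointedType)
    (q : seq ({nonneg R} * L)) (c : seq A) : set (path_space R L A) :=
  [set x | [seq x y.1 y.2 | y <- q] = c].

Lemma measurable_targets (R : realType) (L : lattice) (A : pointedType)
    (q : seq ({nonneg R} * L)) (c : seq A) : measurable (targets q c).
Proof.
rewrite /targets; elim: q c => [|y q IH] [|a c] /=.
- by rewrite (_ : [set _ | _] = setT)//; apply/seteqP.
- by rewrite (_ : [set _ | _] = set0)//; apply/seteqP; split.
- by rewrite (_ : [set _ | _] = set0)//; apply/seteqP; split.
rewrite (_ : [set _ | _] = [set x : path_space R L A | x y.1 y.2 = a] `&`
    [set x | [seq x y.1 y.2 | y <- q] = c]).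
  apply: measurableI => //; apply: sub_sigma_algebra.
  by exists y.1, y.2, a.
by apply/seteqP; split => x /=; [move=> [-> ->]|move=> [-> ->]].
Qed.

(** Prescribing finitely many values defines a generating pi-system, once the
    empty set is added. *)
Lemma path_law_unique (R : realType) (L : lattice) (A : pointedType)
    (m1 m2 : probability (path_space R L A) R) :
  (forall q c, m1 (targets q c) = m2 (targets q c)) ->
  forall B, measurable B -> m1 B = m2 B.
Proof.
move=> m12.
pose G : set (set (path_space R L A)) := [set B | B = set0 \/ exists q c, B = targets q c].
have mG : (measurable : set (set (path_space R L A))) = <<s G >>.
  apply/seteqP; split; last first.
    apply: smallest_sub; first exact: sigma_algebra_measurable.
    by move=> _ [->|[q [c ->]]]; [exact: measurable0|exact: measurable_targets].
  apply: smallest_sub; first exact: smallest_sigma_algebra.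
  move=> _ [t [j [a ->]]]; apply: sub_sigma_algebra; right.
  exists [:: (t, j)], [:: a]; apply/seteqP; split => x; rewrite /targets /=.
    by move=> ->.
  by case.
move=> B mB; apply: (measure_unique G (fun=> setT)) => //.
- move=> B1 B2 [->|[q [c ->]]]; first by rewrite set0I; left.
  move=> [->|[q' [c' ->]]]; first by rewrite setI0; left.
  have [sc|sc] := eqVneq (size c) (size q); last first.
    left; apply/seteqP; split => // x [/= xc _].
    by move: sc; rewrite -xc size_map eqxx.
  right; exists (q ++ q'), (c ++ c'); apply/seteqP; split => x; rewrite /targets /= map_cat.
    by move=> [-> ->].
  by move=> /eqP; rewrite eqseq_cat ?size_map// => /andP[/eqP ? /eqP].
- by move=> _; right; exists [::], [::]; apply/seteqP; split => // x _.
- by rewrite bigcup_const.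
- by move=> C [->|[q [c ->]]]; [rewrite !measure0|exact: m12].
- by move=> _; rewrite /= probability_setT ltry.
Qed.

Section uniqueness.
Context (R : realType) (L : lattice) (A : pointedType).
Hypotheses (cA : countable [set: A]) (causalL : causal_exp1 R L).
Variables (P : transition_matrix R L A) (mu0 : probability (config L A) R).

Section one_trajectory.
Context d (T : measurableType d) (Pr : probability T R) (rho : waiting_times L Pr).
Variables (S : samples L A T) (X : {RV Pr >-> path_space R L A}).
Hypotheses (rho1 : exp1 rho) (SP : samples_from Pr P S)
  (X0mu : forall B : set (config L A), measurable B ->
     Pr [set w | B (X w (NngNum (lexx 0)))] = mu0 B)
  (ind : independent Pr (driving rho S X))
  (dyn : {ae Pr, forall w, constant_between_clocks rho X w /\
                           updated_at_clocks rho S X w}).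

Lemma independent_clocks : independent Pr (fun p : nat * L => sigma_RV (rho p.1 p.2)).
Proof.
apply: (independent_sub (phi := fun p : nat * L => inl (inr p)) _ _ ind) => [p p'|[n j]//].
by case.
Qed.

Lemma well_driven_ae : {ae Pr, forall w, well_driven rho S X w}.
Proof.
by move: (regular_ae causalL rho1 independent_clocks) dyn; apply: filterS2 => w ? [].
Qed.

Lemma measurable_initial :
  measurable_fun setT (fun w => X w (NngNum (lexx 0)) : config L A).
Proof.
apply: (@measurability _ _ T (config L A) [set: T]
  (fun w => X w (NngNum (lexx 0))) (@config_cylinders L A)) => //.
move=> _ [_ [j [a ->]] <-]; rewrite setTI.
rewrite (_ : _ @^-1` _ = X @^-1` [set x | x (NngNum (lexx 0)) j = a])//.
apply: measurable_funPTI; apply: sub_sigma_algebra.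
by exists (NngNum (lexx 0)), j, a.
Qed.

Definition weight (q : seq ({nonneg R} * L)) (c : seq A)
    (m : probability (fun_space R (nat * L)%type) R) (ua : skeleton L * seq A) :=
  if pselect (admissible c ua) then
    (m (first_realised q m ua.1) *
     \prod_(i <- equation_indices ua.1) equation_weight P mu0 ua.1 ua.2 i)%E
  else 0%E.

(** Discarding the null set [N] of sample points that are not well driven makes
    the explanations disjoint. *)
Lemma explained_event q c (m : probability (fun_space R (nat * L)%type) R) :
  (forall B, measurable B -> Pr (joint (fun p : nat * L => rho p.1 p.2) @^-1` B) = m B) ->
  exists E : skeleton L * seq A -> set T, [/\ forall i, measurable (E i),
    forall i j w, E i w -> E j w -> i = j, forall i, Pr (E i) = weight q c m i &
    Pr [set w | [seq X w x.1 x.2 | x <- q] = c] = Pr (\bigcup_i E i)].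
Proof.
move=> Ym.
have finN := causal_finite_nbhd rho1 independent_clocks causalL.
have [N [mN N0 NX]] := well_driven_ae.
have NwX w : ~ N w -> well_driven rho S X w.
  by move=> Nw; apply: contrapT => nX; apply: Nw; exact: NX.
pose E i := explanation q c m rho S X i.
have EE u a : admissible c (u, a) -> E (u, a) =
    [set w | first_realised q m u (joint (fun p : nat * L => rho p.1 p.2) w)] `&`
    [set w | forall p, p \in nodes u ->
      compatible (fun w => X w (NngNum (lexx 0))) S u a w p].
  by move=> adm; apply/seteqP; split => w; [case|case].
have E0 ua : ~ admissible c ua -> E ua = set0.
  by move=> nadm; apply/seteqP; split => // w [].
have mE i : measurable (E i).
  case: i => u a; have [adm|/E0 ->//] := pselect (admissible c (u, a)).
  by rewrite EE//; exact: (measurable_explanation_equations q m rho SP measurable_initial u a).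
have cI : countable [set: skeleton L * seq A].
  have /countable_injP[code code_inj] := cA.
  apply/countable_injP; exists (fun ua => pickle (ua.1, map code ua.2)).
  move=> [u a] [v b] _ _ /(pcan_inj pickleK) [-> /inj_map ->//].
  by move=> x y; apply: code_inj; rewrite inE.
exists (fun i => E i `\` N); split.
- by move=> i; exact: measurableD.
- by move=> i j w [Ei Nw] [Ej _]; exact: (explanation_inj (NwX _ Nw) Ei Ej).
- move=> i; rewrite /weight; transitivity (Pr (E i)).
    apply: ae_eq_measure => //; first exact: measurableD.
    by exists N; split => // w /= nEN; apply: contrapT => Nw; apply: nEN; split => [[]|].
  case: i => u a; case: (pselect (admissible c (u, a))) => /= [adm|nadm]; last first.
    by rewrite E0// measure0.
  have [cu _ _] := adm; rewrite EE//.
  exact: (explanation_weight q SP X0mu ind Ym measurable_initial a cu).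
- apply: ae_eq_measure.
  + rewrite (_ : [set _ | _] = X @^-1` [set x | [seq x y.1 y.2 | y <- q] = c])//.
    by apply: measurable_funPTI; exact: measurable_targets.
  + by apply: countable_bigcupT_measurable => // i; exact: measurableD.
  + exists N; split => // w /= H; apply: contrapT => Nw; apply: H.
    have ee := exists_explanation finN q c m (NwX _ Nw).
    split=> [/ee[i Ei]|[i _ [Ei _]]]; first by exists i.
    by apply/ee; exists i.
Qed.

End one_trajectory.

(** The probability of every finite collection of values is a sum of weights
    that only depend on the joint law of the clocks, on [P] and on [mu0]. *)
Theorem trajectory_law_unique
    d1 (T1 : measurableType d1) (Pr1 : probability T1 R)
    d2 (T2 : measurableType d2) (Pr2 : probability T2 R)
    (X1 : {RV Pr1 >-> path_space R L A}) (X2 : {RV Pr2 >-> path_space R L A}) :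
  trajectory P mu0 X1 -> trajectory P mu0 X2 ->
  forall B, measurable B -> distribution Pr1 X1 B = distribution Pr2 X2 B.
Proof.
move=> [rho1 [S1 [e1 s1 i1 ind1 dyn1]]] [rho2 [S2 [e2 s2 i2 ind2 dyn2]]].
apply: path_law_unique => q c.
pose m := distribution Pr1 (joint (fun p : nat * L => rho1 p.1 p.2)).
have [|E1 [mE1 tE1 w1 q1]] := @explained_event _ _ _ _ _ _ e1 s1 i1 ind1 dyn1 q c m.
  by [].
have [|E2 [mE2 tE2 w2 q2]] := @explained_event _ _ _ _ _ _ e2 s2 i2 ind2 dyn2 q c m.
  move=> B mB; apply/esym.
  exact: (iid_exp_joint_law (iid_clocks e1 (independent_clocks ind1))
    (iid_clocks e2 (independent_clocks ind2)) mB).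
have /countable_injP[code code_inj] := cA.
pose code' (ua : skeleton L * seq A) := pickle (ua.1, map code ua.2).
have code'_inj : injective code'.
  move=> [u a] [v b] /(pcan_inj pickleK) [-> /inj_map ->//].
  by move=> x y; apply: code_inj; rewrite inE.
rewrite /distribution /pushforward [LHS]q1 [RHS]q2.
by apply: (eq_measure_bigcup code'_inj) => // i; exact: etrans (w1 i) (esym (w2 i)).
Qed.

End uniqueness.

(** * From thinned clocks to lazy updates *)

Section success_indices.
Context (R : realType) (lam : R).
Local Notation Omega := (fun_space R nat).
Variable y : Omega.

(** The coordinates of a sequence come in pairs, one for each ring of a clock.
    The [m]-th success is the last ring used up by the first [m] thinned ones. *)
Fixpoint rings_used (m : nat) : nat :=
  if m is m'.+1 then
    rings_used m' + (first_success lam (sskip (rings_used m').*2 y)).+1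
  else 0.

Lemma iter_after_success m :
  iter m (after_success lam) y = sskip (rings_used m).*2 y.
Proof.
elim: m => [|m IH]; first by apply/funext => n; rewrite /sskip add0n.
by rewrite iterS IH /after_success /= doubleD; apply/funext => n;
  rewrite /sskip addnA.
Qed.

Lemma rings_used_ltS m : (rings_used m < rings_used m.+1)%N.
Proof. by rewrite /= -[ltnLHS]addn0 ltn_add2l. Qed.

Lemma rings_used_between n : exists m, (rings_used m <= n < rings_used m.+1)%N.
Proof.
elim: n => [|n [m /andP[mn nm]]]; first by exists 0%N; exact: (rings_used_ltS 0).
move: nm; rewrite leq_eqVlt => /orP[/eqP nm|nm].
  by exists m.+1; rewrite {1 2}nm leqnn; exact: (rings_used_ltS m.+1).
by exists m; rewrite (leq_trans mn)//= nm.
Qed.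

Lemma sum_thin m :
  \sum_(k < m) thin lam y k.*2 = lam * \sum_(k < rings_used m) y k.*2.
Proof.
elim: m => [|m IH]; first by rewrite !big_ord0 mulr0.
rewrite big_ord_recr IH /= big_split_ord/= mulrDr; congr (_ + _).
rewrite /thin odd_double doubleK iter_after_success /waiting; congr (_ * _).
by apply: eq_bigr => i _; rewrite /sskip doubleD.
Qed.

Lemma thin_odd m :
  thin lam y m.*2.+1 = y (rings_used m.+1).-1.*2.+1 - threshold lam.
Proof.
rewrite /thin /= odd_double/= uphalf_double iter_after_success /residual.
by rewrite /sskip /= !addnS /= doubleD.
Qed.

Lemma rings_used_success m : infinitely_many lam y -> success lam y (rings_used m.+1).-1.
Proof.
move=> yi; rewrite /= addnS /= -success_sskip; apply: success_first.
exact/infinitely_many_sskip.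
Qed.

Lemma rings_used_failure m n : (rings_used m <= n)%N -> (n.+1 < rings_used m.+1)%N ->
  ~~ success lam y n.
Proof.
move=> mn; rewrite /= addnS ltnS => nm.
rewrite -(subnKC mn) -success_sskip; apply: first_index_before.
by rewrite ltn_subLR.
Qed.

End success_indices.

Section thinned_dynamics.
Context (R : realType) (L : lattice) (A : pointedType).
Context d (T : measurableType d) (Pr : probability T R).
Variable y : nat * L -> {RV Pr >-> R}.
Variables (lam : R) (lam0 : 0 < lam).
Variable Phi : forall j : L, (nbhd j -> A) -> R -> A.

(** A mark below the threshold leaves the site unchanged; a mark above it is,
    by lack of memory, reused to sample from the original matrix. *)
Definition lazy_sampler (j : L) (sigma : nbhd j -> A) (x : R) : A :=
  if threshold lam < x then Phi sigma (x - threshold lam)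
  else sigma (self_nbhd j).

Local Notation rhoQ := (even_times y).
Local Notation rhoP := (even_times (thinned lam y)).

Variables (X : T -> path_space R L A) (w : T).
Hypotheses (pos : forall p : nat * L, 0 < rhoQ p.1 p.2 w)
  (inf : forall j, infinitely_many lam (fun k => y (k, j) w))
  (Xconst : constant_between_clocks rhoP X w)
  (Xupd : updated_at_clocks rhoP (odd_samples Phi (thinned lam y)) X w).

Let rings (j : L) := rings_used lam (fun k => y (k, j) w).

Lemma tau_thinned m j : tau rhoP m j w = lam * tau rhoQ (rings j m) j w.
Proof. exact: (sum_thin lam (fun k => y (k, j) w) m). Qed.

Let X_slow m j (t : {nonneg R}) :
  lam * tau rhoQ (rings j m) j w <= t%:num < lam * tau rhoQ (rings j m.+1) j w ->
  X w t j = X w (NngNum (normr_ge0 (tau rhoP m j w))) j.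
Proof.
move=> mt; apply: (Xconst (n := m)); last by rewrite !tau_thinned.
rewrite /= ger0_norm// tau_thinned mulr_ge0 ?(ltW lam0)//.
exact: tau_ge0.
Qed.

Lemma rescaled_constant :
  constant_between_clocks rhoQ (rescale (ltW lam0) \o X) w.
Proof.
move=> n j s t sE /andP[nt tn].
have [m /andP[mn nm]] := rings_used_between lam (fun k => y (k, j) w) n.
have mn' := tau_le pos j mn; have nm' := tau_le pos j nm.
by rewrite /= /rescale (X_slow (m := m)) ?[RHS](X_slow (m := m))//=;
  rewrite ?sE !ler_pM2l// !ltr_pM2l//;
  [rewrite mn'/= (lt_le_trans _ nm')// tau_ltS
  |rewrite (le_trans mn' nt)/= (lt_le_trans tn)].
Qed.

(** A success is a ring of the thinned clock, so the update is one of [X]; a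
    failure lies strictly between two thinned rings, where the path does not
    change. *)
Lemma rescaled_updated :
  updated_at_clocks rhoQ (odd_samples lazy_sampler y) (rescale (ltW lam0) \o X) w.
Proof.
move=> n j s sigma sE lim.
have [m /andP[mn nm]] := rings_used_between lam (fun k => y (k, j) w) n.
have mn' := tau_le pos j mn; have nm' := tau_le pos j nm.
rewrite /odd_samples /lazy_sampler.
move: (nm); rewrite leq_eqVlt => /orP[/eqP nk|nk].
  have := rings_used_success (lam := lam) m (inf j).
  rewrite -nk /success /= => ->.
  rewrite /= /rescale.
  rewrite (Xupd (n := m) (sigma := sigma)) /odd_samples; last 2 first.
  - by rewrite [LHS]/= sE tau_thinned /rings -nk.
  - move=> i; have [e e0 He] := lim i.
    exists (lam * e); first by rewrite mulr_gt0.
    move=> u /= /andP[eu us].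
    have u0 : 0 <= u%:num / lam by rewrite divr_ge0// ltW.
    rewrite -(He (NngNum u0)); last first.
      by rewrite /= ltr_pdivlMr// ltr_pdivrMr// mulrBl ![_ * lam]mulrC eu.
    rewrite /= /rescale; congr (X w _ _); apply: val_inj => /=.
    by rewrite mulrC divfK// gt_eqF.
  by congr (Phi sigma _); rewrite thinnedE thin_odd -nk.
have := rings_used_failure (m := m) mn nk; rewrite /success => /negbTE ->.
have [e e0 He] := lim (self_nbhd j).
(* A time just before the update, after the previous ring of the same clock. *)
pose u := Num.max (tau rhoQ n j w) (s%:num - e / 2).
have u0 : 0 <= u by rewrite le_max tau_ge0.
have us : u < s%:num.
  by rewrite gt_max sE tau_ltS//= ltrBlDr ltrDl divr_gt0.
rewrite -(He (NngNum u0)); last first.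
  rewrite /= us andbT lt_max; apply/orP; right.
  by rewrite ltrD2l ltrN2 ltr_pdivrMr// ltr_pMr// ltr1n.
have nk' := tau_lt pos j nk.
rewrite /= /rescale (X_slow (m := m)) ?[RHS](X_slow (m := m))//=.
  rewrite ler_pM2l// ltr_pM2l// (lt_le_trans us) ?sE ?(ltW nk')// andbT.
  by rewrite le_max mn'.
rewrite ler_pM2l// ltr_pM2l// sE nk' andbT (le_trans mn')// ltW// tau_ltS//.
Qed.

End thinned_dynamics.

(** * The coupling and the equivalence *)

Section coupling.
Context (R : realType) (L : lattice) (A : pointedType).
Hypotheses (cA : countable [set: A]) (causalL : causal_exp1 R L).
Variables (P : transition_matrix R L A) (lam : R) (lam0 : 0 < lam) (lam1 : lam <= 1).

Lemma exists_transition_sampler :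
  exists Phi : forall j : L, (nbhd j -> A) -> R -> A,
  forall j (sigma : nbhd j -> A) a, measurable [set x | Phi j sigma x = a] /\
    expo R [set x | Phi j sigma x = a] = (P j sigma a)%:E.
Proof.
have /countable_injP[code code_inj] := cA.
have code_inj' : injective code by move=> a b; apply: code_inj; rewrite inE.
pose ex j (sigma : nbhd j -> A) := exists_sampler code_inj'
  (fun a => entry_ge0 P sigma a) (entry_sum1 P sigma).
by exists (fun j sigma => sval (cid (@ex j sigma))) => j sigma a;
  exact: (svalP (cid (@ex j sigma))).
Qed.

Section lazy.
Variable Phi : forall j : L, (nbhd j -> A) -> R -> A.
Hypothesis PhiP : forall j (sigma : nbhd j -> A) a,
  measurable [set x | Phi sigma x = a] /\
  expo R [set x | Phi sigma x = a] = (P j sigma a)%:E.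

(** On rays this says that the tail at [threshold lam + t] is [lam * tail t] for
    nonnegative [t]; rays determine the measure. *)
Lemma expo_memoryless (B : set R) : measurable B ->
  measurable [set x | threshold lam < x /\ B (x - threshold lam)] /\
  expo R [set x | threshold lam < x /\ B (x - threshold lam)] =
  (lam%:E * expo R B)%E.
Proof.
move=> mB.
have msub : measurable_fun setT (fun x : R => x - threshold lam).
  exact: measurable_funB.
have mT : measurable (`]threshold lam, +oo[%classic : set (measurableTypeR R)) by [].
have setE (C : set R) : [set x | threshold lam < x /\ C (x - threshold lam)] =
    (fun x => x - threshold lam) @^-1` C `&` `]threshold lam, +oo[%classic.
  by apply/seteqP; split => x; rewrite /= in_itv/= andbT => -[].
have mE (C : set R) : measurable C ->
    measurable [set x | threshold lam < x /\ C (x - threshold lam)].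
  move=> mC; rewrite setE; apply: measurableI => //.
  by rewrite -[X in measurable X]setTI; exact: msub.
split; first exact: mE.
pose f : {mfun (measurableTypeR R) >-> (measurableTypeR R)} :=
  HB.pack (fun x : R => x - threshold lam)
    (isMeasurableFun.Build _ _ (measurableTypeR R) (measurableTypeR R)
      (fun x : R => x - threshold lam) msub).
rewrite -(expo_ray_unique (m := pushforward (mrestr (expo R) mT) f) (ltW lam0))//.
  by rewrite setE.
move=> t; rewrite -(tail_threshold lam0 lam1) -expo_ray /pushforward /mrestr.
congr (expo R _); apply/seteqP; split => x; rewrite /= !in_itv/= !andbT.
  by move=> [tx thx]; rewrite -ltrBrDl gt_max subr_gt0 thx.
by rewrite -ltrBrDl gt_max subr_gt0 => /andP[].
Qed.

Lemma lazy_samplerP j (sigma : nbhd j -> A) a :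
  measurable [set x | lazy_sampler lam Phi sigma x = a] /\
  expo R [set x | lazy_sampler lam Phi sigma x = a] =
  (conv_matrix (ltW lam0) lam1 P (id_matrix R L A) j sigma a)%:E.
Proof.
have [mPhi PhiE] := PhiP sigma a; have [mS SE] := expo_memoryless mPhi.
pose stay : set R :=
  if sigma (self_nbhd j) == a then `]-oo, threshold lam]%classic else set0.
have mstay : measurable stay by rewrite /stay; case: ifP.
rewrite (_ : [set x | _] =
    [set x | threshold lam < x /\ Phi sigma (x - threshold lam) = a] `|` stay).
  split; first exact: measurableU.
  rewrite measureU//; last first.
    apply/seteqP; split => // x [/= [tx _]]; rewrite /stay; case: ifP => //= _.
    by rewrite in_itv/= leNgt tx.
  rewrite [X in (X + _)%E = _]SE PhiE /= /conv_entry EFinD EFinM; congr (_ + _)%E.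
  rewrite /stay /= /id_entry; case: eqP => _ /=; last by rewrite measure0 mulr0.
  by rewrite mulr1 expo_failure.
apply/seteqP; split => x; rewrite /= /lazy_sampler /stay.
  case: ltP => [tx <-|xt sa]; first by left.
  by right; rewrite sa eqxx /= in_itv.
move=> [[-> //]|]; case: eqP => //= <-; rewrite in_itv/= => xt.
by rewrite ltNge xt.
Qed.

End lazy.

Variables (mu0 : probability (config L A) R).
Context d (T : measurableType d) (Pr : probability T R).
Variable X0 : {RV Pr >-> path_space R L A}.
Variable y : nat * L -> {RV Pr >-> R}.
Hypotheses (y_exp : exp_driver (sigma_initial X0) y)
  (X0mu : forall B : set (config L A), measurable B ->
     Pr [set w | B (X0 w (NngNum (lexx 0)))] = mu0 B).

Let Xini (w : T) : config L A := X0 w (NngNum (lexx 0)).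

Let infinitely_many_columns :
  {ae Pr, forall w, forall j, infinitely_many lam (fun k => y (k, j) w)}.
Proof.
apply: ae_forall_countable => j; have [y1 yi] := y_exp.
have yc : iid_exp (fun n => y (n, j)).
  split=> [n C mC|]; first by rewrite y1// expoE.
  apply: (independent_sub (phi := fun n => inr (n, j)) _ _ yi) => [|n] //.
  by move=> n k [].
have [N [mN N0 NI]] := infinitely_many_ae lam0 lam1 (joint_iid yc).
exists (joint (fun n => y (n, j)) @^-1` N); split => //.
  exact: measurable_funPTI.
by move=> w nw; apply: NI.
Qed.

(** The process is constructed from the thinned clocks.  For the original
    clocks, the successes are updates of [P], and the failures update a site to
    the value it already has. *)
Lemma coupling : exists X : {RV Pr >-> path_space R L A},
  trajectory (Pr := Pr) P mu0 X /\
  trajectory (Pr := Pr) (conv_matrix (ltW lam0) lam1 P (id_matrix R L A)) mu0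
    (rescale (ltW lam0) \o X).
Proof.
have [Phi PhiP] := exists_transition_sampler.
have mXini := measurable_initial X0.
have mini : sigma_initial X0 `<=` measurable.
  by move=> _ [B mB <-]; exact: mXini.
have inI : setI_closed (sigma_initial X0).
  move=> _ _ [B mB <-] [C mC <-]; exists (B `&` C); first exact: measurableI.
  by rewrite !setTI preimage_setI.
have z_exp := exp_driver_thinned mini inI lam0 lam1 y_exp.
pose z := thinned lam y; pose rhoP := even_times z; pose SP := odd_samples Phi z.
have rhoP1 : exp1 rhoP := exp1_even_times z_exp.
have SPP : samples_from Pr P SP := odd_samples_from PhiP z_exp.
have indP := independent_driving PhiP z_exp.
have rhoPi := independent_clocks indP.
have finN := causal_finite_nbhd rhoP1 rhoPi causalL.
have mX : measurable_fun setT (graphical rhoP SP Xini).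
  apply: measurable_graphical => //.
    move=> j a; rewrite (_ : [set _ | _] = Xini @^-1` [set z | z j = a])//.
    rewrite -[X in measurable X]setTI; apply: mXini => //.
    by apply: sub_sigma_algebra; exists j, a.
  by move=> n j sigma a; have [] := SPP n j sigma a.
pose X : {RV Pr >-> path_space R L A} := HB.pack (graphical rhoP SP Xini)
  (isMeasurableFun.Build _ _ T (path_space R L A) (graphical rhoP SP Xini) mX).
have XX0 w : X w (NngNum (lexx 0)) = X0 w (NngNum (lexx 0)).
  by apply/funext => j; rewrite /= /graphical /= eqxx.
have XlX0 w : (rescale (ltW lam0) \o X) w (NngNum (lexx 0)) = X0 w (NngNum (lexx 0)).
  rewrite -XX0 /= /rescale; congr (graphical _ _ _ w _).
  by apply: val_inj; rewrite /= mulr0.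
have reg := regular_ae causalL rhoP1 rhoPi.
have iniX : sigma_initial X = sigma_initial X0.
  by rewrite /sigma_initial (funext XX0).
have iniXl : sigma_initial (rescale (ltW lam0) \o X) = sigma_initial X0.
  by rewrite /sigma_initial (funext XlX0).
exists X; split.
  exists rhoP, SP; split => //.
  - move=> B mB; rewrite -X0mu//; congr (Pr _).
    by apply/funext => w; exact: (congr1 B (XX0 w)).
  - by apply: (independent_driving PhiP); rewrite iniX.
  - move: reg; apply: filterS => w rw; split; first exact: graphical_constant.
    exact: graphical_updated.
exists (even_times y), (odd_samples (lazy_sampler lam Phi) y); split.
- exact: exp1_even_times y_exp.
- exact: (odd_samples_from (lazy_samplerP PhiP) y_exp).
- move=> B mB; rewrite -X0mu//; congr (Pr _).
  by apply/funext => w; exact: (congr1 B (XlX0 w)).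
- by apply: (independent_driving (lazy_samplerP PhiP)); rewrite iniXl.
- move: reg (clocks_positive (exp1_even_times y_exp)) infinitely_many_columns.
  apply: filterS3 => w rw pos inf.
  have cX : constant_between_clocks rhoP X w by exact: graphical_constant.
  have uX : updated_at_clocks rhoP SP X w by exact: graphical_updated.
  by split; [exact: rescaled_constant|exact: rescaled_updated].
Qed.

End coupling.

Lemma trajectory_exp_driver (R : realType) (L : lattice) (A : pointedType)
    d (T : measurableType d) (Pr : probability T R) (rho : waiting_times L Pr)
    (S : samples L A T) (X : T -> path_space R L A) :
  exp1 rho -> independent Pr (driving rho S X) ->
  exp_driver (sigma_initial X) (fun p => rho p.1 p.2).
Proof.
move=> rho1 ind; split.
  by move=> p B mB; rewrite expoE -(rho1 p.1 p.2 B mB).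
pose phi (i : unit + nat * L) : unit + nat * L + nat * L := inl i.
apply: (independent_sub (phi := phi) _ _ ind) => [i j []//|[[]|[n j]]//].
Qed.

Theorem lemma4p1 (R : realType) (L : lattice) (A : pointedType)
    (countableA : countable [set: A]) (P : transition_matrix R L A)
    (causalL : causal_exp1 R L)
    (lam : R) (lam0 : 0 < lam) (lam1 : lam <= 1)
    (d : measure_display) (T : measurableType d) (Pr : probability T R)
    (zeta : {RV Pr >-> path_space R L A}) :
  IPS P (distribution Pr zeta) <->
  IPS (conv_matrix (ltW lam0) lam1 P (id_matrix R L A))
    (distribution Pr (rescale (ltW lam0) \o zeta)).
Proof.
have mresc (k : R) (k0 : 0 <= k) (B : set (path_space R L A)) : measurable B ->
    measurable (rescale k0 @^-1` B).
  by move=> mB; exact: measurable_funPTI.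
(* In both directions the given trajectory is replaced by the coupled one. *)
split=> -[mu0 [d' [T' [Pr' [X' [trX' lawX']]]]]];
  have [rho [S [rho1 _ ini ind _]]] := trX';
  have [X [trP trQ]] := coupling countableA causalL P lam0 lam1
    (trajectory_exp_driver rho1 ind) ini;
  exists mu0, d', T', Pr'.
  exists (rescale (ltW lam0) \o X); split => // B mB.
  have mB' := mresc _ (ltW lam0) _ mB.
  have := lawX' _ mB'.
  by rewrite (trajectory_law_unique countableA causalL trX' trP mB').
exists X; split => // B mB.
(* The law of [zeta] is recovered by undoing the change of time. *)
have lamV0 : 0 <= lam^-1 by rewrite invr_ge0 ltW.
have rescK (x : path_space R L A) : rescale lamV0 (rescale (ltW lam0) x) = x.
  apply/funext => t; rewrite /rescale; congr (x _); apply: val_inj => /=.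
  by rewrite mulrA mulfV ?mul1r// gt_eqF.
have mB' := mresc _ lamV0 _ mB.
have := lawX' _ mB'.
rewrite (trajectory_law_unique countableA causalL trX' trQ mB').
rewrite /distribution /pushforward.
have preE (U : Type) (f : U -> path_space R L A) :
    (rescale (ltW lam0) \o f) @^-1` (rescale lamV0 @^-1` B) = f @^-1` B.
  by apply/seteqP; split => u /=; rewrite rescK.
move=> h; apply: etrans (etrans h _); first by congr (Pr _); exact/esym/preE.
by congr (Pr' _); exact: preE.
Qed.
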